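(* Let $\mathbb{F}$ be a field, $\Gamma$ a digraph, $L(\Gamma)=L_{\mathbb{F}}(\Gamma)$, and let $P$ be a finitely generated indecomposable projective (fgip) $L(\Gamma)$-module. If $P$ is not simple then $P\cong vL(\Gamma)$ where $v\in V$ is on a cycle with no exit. There is a one-to-one correspondence between the cycles in $\Gamma$ with no exit and the isomorphism classes of non-simple fgip $L(\Gamma)$-modules, which maps a cycle $C$ to the isomorphism class of $vL(\Gamma)$ where $v$ is a vertex on $C$. In the reverse direction, given a non-simple fgip $P$, the corresponding cycle is the unique cycle with no exit in the support subgraph $\Gamma_P$.
   Context: A digraph $\Gamma=(V,E,s,t)$ consists of arbitrary (possibly infinite) sets $V$ of vertices and $E$ of arrows and functions $s,t:E\to V$ (source, target). The Leavitt path algebra $L(\Gamma)=L_{\mathbb{F}}(\Gamma)$ is the (not necessarily unital) $\mathbb{F}$-algebra generated by $V\sqcup E\sqcup\{e^*: e\in E\}$ subject to: $uv=\delta_{u,v}u$ for $u,v\in V$; $s(e)e=e=e\,t(e)$ and $t(e)e^*=e^*=e^*s(e)$ for $e\in E$; (CK1) $e^*f=\delta_{e,f}t(e)$; (CK2) $v=\sum_{s(e)=v}ee^*$ for every $v$ with $0<|s^{-1}(v)|<\infty$. Modules are unital right modules ($M=ML(\Gamma)$). A path of length $n>0$ is a sequence of arrows $e_1\cdots e_n$ with $t(e_i)=s(e_{i+1})$. A cycle is a path $C=e_1\cdots e_n$ with $n>0$, $s(C)=t(C)$ and $s(e_1),\dots,s(e_n)$ distinct; cycles differing by a cyclic rotation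 are identified. An exit of a path $p$ is an arrow not on $p$ whose source is a vertex on $p$. For an $L(\Gamma)$-module $M$ the support is $V_M=\{v\in V: Mv\neq0\}$ and the support subgraph $\Gamma_M$ is the full subgraph of $\Gamma$ on $V_M$. *)

(* Defs.v *)
From HB Require Import structures.
From mathcomp Require Import all_boot all_algebra.
From mathcomp Require Import boolp classical_sets.

Set Implicit Arguments.
Unset Strict Implicit.
Unset Printing Implicit Defensive.

Import GRing.Theory.
Local Open Scope ring_scope.
Local Open Scope classical_set_scope.
Local Open Scope quotient_scope.

(* This is [set_bij], which cannot be used for classes of modules: [set] is
   itself a choiceType, hence [set (rmodType A)] is a universe inconsistency. *)
Definition bijective_between (T U : Type) (A : T -> Prop) (B : U -> Prop)
    (f : T -> U) : Prop :=
  [/\ forall x, A x -> B (f x),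
      forall x y, A x -> A y -> f x = f y -> x = y &
      forall z, B z -> exists2 x, A x & f x = z].

HB.mixin Record Lmodule_isNuAlgebra (F : fieldType) A of GRing.Lmodule F A := {
  nmul : A -> A -> A;
  nmulA : associative nmul;
  nmulDl : left_distributive nmul +%R;
  nmulDr : right_distributive nmul +%R;
  nscaleAl : forall (k : F) (x y : A), k *: nmul x y = nmul (k *: x) y;
  nscaleAr : forall (k : F) (x y : A), k *: nmul x y = nmul x (k *: y)
}.

#[short(type="nuAlgType")]
HB.structure Definition NuAlgebra (F : fieldType) :=
  {A of Lmodule_isNuAlgebra F A & GRing.Lmodule F A}.

(* The last axiom is M = MA: every element is a finite sum of products m a. *)
HB.mixin Record Lmodule_isRightModule (F : fieldType) (A : nuAlgType F) M
    of GRing.Lmodule F M := {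
  ract : M -> A -> M;
  ractDl : forall x y a, ract (x + y) a = ract x a + ract y a;
  ractDr : forall x a b, ract x (a + b) = ract x a + ract x b;
  ractZl : forall (k : F) x a, ract (k *: x) a = k *: ract x a;
  ractZr : forall (k : F) x a, ract x (k *: a) = k *: ract x a;
  ractA : forall x a b, ract (ract x a) b = ract x (nmul a b);
  ract_unital : forall x, exists r : seq (M * A), x = \sum_(p <- r) ract p.1 p.2
}.

#[short(type="rmodType")]
HB.structure Definition RightModule (F : fieldType) (A : nuAlgType F) :=
  {M of Lmodule_isRightModule F A M & GRing.Lmodule F M}.

Section ModuleTheory.
Variables (F : fieldType) (A : nuAlgType F).
Implicit Types M N P Q : rmodType A.

Definition module_hom M N (f : {linear M -> N}) : Prop :=
  forall (x : M) (a : A), f (ract x a) = ract (f x) a.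

Definition module_iso M N : Prop :=
  exists2 f : {linear M -> N}, module_hom f & bijective f.

Definition iso_class M : rmodType A -> Prop := fun N => module_iso M N.

Definition submodule M (S : set M) : Prop :=
  [/\ S 0, (forall x y, S x -> S y -> S (x + y)),
      (forall (k : F) x, S x -> S (k *: x)) &
      (forall x (a : A), S x -> S (ract x a))].

Definition finitely_generated M : Prop :=
  exists r : seq M,
    forall S : set M, submodule S -> (forall x, x \in r -> S x) -> S = setT.

Definition nontrivial M : Prop := exists x : M, x != 0.

Definition simple M : Prop :=
  nontrivial M /\
  forall S : set M, submodule S -> S = [set 0] \/ S = setT.

Definition indecomposable M : Prop :=
  nontrivial M /\
  forall S T : set M, submodule S -> submodule T ->
    (forall x, exists y z, [/\ S y, T z & x = y + z]) ->
    S `&` T = [set 0] ->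
    S = [set 0] \/ T = [set 0].

Definition projective P : Prop :=
  forall M N (g : {linear M -> N}) (f : {linear P -> N}),
    module_hom g -> module_hom f -> (forall y, exists x, g x = y) ->
    exists2 h : {linear P -> M}, module_hom h & forall x, g (h x) = f x.

Definition fgip P : Prop :=
  [/\ finitely_generated P, indecomposable P & projective P].

End ModuleTheory.

Inductive expr (F X : Type) : Type :=
  | Gen of X
  | Zero
  | Add of expr F X & expr F X
  | Scale of F & expr F X
  | Mul of expr F X & expr F X.
Arguments Gen {F X}.
Arguments Zero {F X}.
Arguments Add {F X}.
Arguments Scale {F X}.
Arguments Mul {F X}.

(* The least congruence containing R and the axioms of a not necessarily
   unital F-algebra; the opposite of x is Scale (-1) x. *)
Inductive congr (F : fieldType) (X : Type) (R : expr F X -> expr F X -> Prop) :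
    expr F X -> expr F X -> Prop :=
  | congr_rel x y of R x y : congr R x y
  | congr_refl x : congr R x x
  | congr_sym x y of congr R x y : congr R y x
  | congr_trans x y z of congr R x y & congr R y z : congr R x z
  | congr_add x x' y y' of congr R x x' & congr R y y' :
      congr R (Add x y) (Add x' y')
  | congr_scale k x x' of congr R x x' : congr R (Scale k x) (Scale k x')
  | congr_mul x x' y y' of congr R x x' & congr R y y' :
      congr R (Mul x y) (Mul x' y')
  | congr_addA x y z : congr R (Add x (Add y z)) (Add (Add x y) z)
  | congr_addC x y : congr R (Add x y) (Add y x)
  | congr_add0 x : congr R (Add Zero x) x
  | congr_scale0 x : congr R (Scale 0 x) Zero
  | congr_scale1 x : congr R (Scale 1 x) x
  | congr_scaleA k l x : congr R (Scale k (Scale l x)) (Scale (k * l) x)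
  | congr_scaleDl k l x :
      congr R (Scale (k + l) x) (Add (Scale k x) (Scale l x))
  | congr_scaleDr k x y :
      congr R (Scale k (Add x y)) (Add (Scale k x) (Scale k y))
  | congr_mulA x y z : congr R (Mul x (Mul y z)) (Mul (Mul x y) z)
  | congr_mulDl x y z : congr R (Mul (Add x y) z) (Add (Mul x z) (Mul y z))
  | congr_mulDr x y z : congr R (Mul x (Add y z)) (Add (Mul x y) (Mul x z))
  | congr_scaleAl k x y : congr R (Scale k (Mul x y)) (Mul (Scale k x) y)
  | congr_scaleAr k x y : congr R (Scale k (Mul x y)) (Mul x (Scale k y)).

HB.instance Definition _ (F X : Type) := gen_eqMixin (expr F X).
HB.instance Definition _ (F X : Type) := gen_choiceMixin (expr F X).

Section PresentedAlgebra.
Variables (F : fieldType) (X : Type) (R : expr F X -> expr F X -> Prop).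

Definition congrb : rel (expr F X) := fun x y => `[< congr R x y >].

Lemma congrb_refl : reflexive congrb.
Proof. by move=> x; apply/asboolP; exact: congr_refl. Qed.

Lemma congrb_sym : symmetric congrb.
Proof. by move=> x y; apply/asboolP/asboolP; exact: congr_sym. Qed.

Lemma congrb_trans : transitive congrb.
Proof.
by move=> y x z /asboolP xy /asboolP yz; apply/asboolP; exact: congr_trans yz.
Qed.

Canonical congrb_equiv := EquivRel congrb congrb_refl congrb_sym congrb_trans.

Definition presented := {eq_quot congrb}.
HB.instance Definition _ := Choice.on presented.
HB.instance Definition _ := EqQuotient.on presented.

Definition pclass (x : expr F X) : presented := \pi_presented x.
Definition padd (x y : presented) := pclass (Add (repr x) (repr y)).
Definition popp (x : presented) := pclass (Scale (-1) (repr x)).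
Definition pscale (k : F) (x : presented) := pclass (Scale k (repr x)).
Definition pmul (x y : presented) := pclass (Mul (repr x) (repr y)).

Lemma pclassP x y : pclass x = pclass y <-> congr R x y.
Proof.
by split=> [/eqmodP /asboolP //|xy]; apply/eqmodP; apply/asboolP.
Qed.

Lemma pclass_ind (T : presented -> Prop) : (forall x, T (pclass x)) -> forall x, T x.
Proof. by move=> Tpi x; rewrite -[x]reprK; exact: Tpi. Qed.

Lemma repr_pclass x : congr R (repr (pclass x)) x.
Proof. by apply/pclassP; exact: reprK. Qed.

Lemma paddE x y : padd (pclass x) (pclass y) = pclass (Add x y).
Proof. by apply/pclassP; apply: congr_add; exact: repr_pclass. Qed.

Lemma pscaleE k x : pscale k (pclass x) = pclass (Scale k x).
Proof. by apply/pclassP; apply: congr_scale; exact: repr_pclass. Qed.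

Lemma poppE x : popp (pclass x) = pclass (Scale (-1) x).
Proof. exact: pscaleE. Qed.

Lemma pmulE x y : pmul (pclass x) (pclass y) = pclass (Mul x y).
Proof. by apply/pclassP; apply: congr_mul; exact: repr_pclass. Qed.

Lemma paddA : associative padd.
Proof.
elim/pclass_ind=> x; elim/pclass_ind=> y; elim/pclass_ind=> z.
by rewrite !paddE; apply/pclassP; exact: congr_addA.
Qed.

Lemma paddC : commutative padd.
Proof.
elim/pclass_ind=> x; elim/pclass_ind=> y.
by rewrite !paddE; apply/pclassP; exact: congr_addC.
Qed.

Lemma padd0 : left_id (pclass Zero) padd.
Proof.
by elim/pclass_ind=> x; rewrite paddE; apply/pclassP; exact: congr_add0.
Qed.

Lemma paddN : left_inverse (pclass Zero) popp padd.
Proof.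
elim/pclass_ind=> x; rewrite poppE paddE; apply/pclassP.
apply: congr_trans (congr_scale0 R x); rewrite -(addNr 1).
apply: congr_sym; apply: congr_trans (congr_scaleDl _ _ _ _) _.
by apply: congr_add; [exact: congr_refl | exact: congr_scale1].
Qed.

HB.instance Definition _ := GRing.isZmodule.Build presented
  paddA paddC padd0 paddN.

Lemma pscaleA k l x : pscale k (pscale l x) = pscale (k * l) x.
Proof.
elim/pclass_ind: x => x; rewrite !pscaleE; apply/pclassP.
exact: congr_scaleA.
Qed.

Lemma pscale1 : left_id 1 pscale.
Proof.
by elim/pclass_ind=> x; rewrite pscaleE; apply/pclassP; exact: congr_scale1.
Qed.

Lemma pscaleDr : right_distributive pscale +%R.
Proof.
move=> k; elim/pclass_ind=> x; elim/pclass_ind=> y.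
rewrite /GRing.add /= paddE !pscaleE paddE; apply/pclassP.
exact: congr_scaleDr.
Qed.

Lemma pscaleDl x : {morph pscale^~ x : k l / k + l}.
Proof.
move=> k l; elim/pclass_ind: x => x.
rewrite [RHS]/GRing.add /= !pscaleE paddE; apply/pclassP.
exact: congr_scaleDl.
Qed.

HB.instance Definition _ := GRing.Zmodule_isLmodule.Build F presented
  pscaleA pscale1 pscaleDr pscaleDl.

Lemma pmulA : associative pmul.
Proof.
elim/pclass_ind=> x; elim/pclass_ind=> y; elim/pclass_ind=> z.
by rewrite !pmulE; apply/pclassP; exact: congr_mulA.
Qed.

Lemma pmulDl : left_distributive pmul +%R.
Proof.
elim/pclass_ind=> x; elim/pclass_ind=> y; elim/pclass_ind=> z.
rewrite /GRing.add /= paddE !pmulE paddE; apply/pclassP.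
exact: congr_mulDl.
Qed.

Lemma pmulDr : right_distributive pmul +%R.
Proof.
elim/pclass_ind=> x; elim/pclass_ind=> y; elim/pclass_ind=> z.
rewrite /GRing.add /= paddE !pmulE paddE; apply/pclassP.
exact: congr_mulDr.
Qed.

Lemma pmulZl (k : F) (x y : presented) : k *: pmul x y = pmul (k *: x) y.
Proof.
elim/pclass_ind: x => x; elim/pclass_ind: y => y.
rewrite /GRing.scale /= pmulE !pscaleE pmulE; apply/pclassP.
exact: congr_scaleAl.
Qed.

Lemma pmulZr (k : F) (x y : presented) : k *: pmul x y = pmul x (k *: y).
Proof.
elim/pclass_ind: x => x; elim/pclass_ind: y => y.
rewrite /GRing.scale /= pmulE !pscaleE pmulE; apply/pclassP.
exact: congr_scaleAr.
Qed.

HB.instance Definition _ := Lmodule_isNuAlgebra.Build F presented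
  pmulA pmulDl pmulDr pmulZl pmulZr.

End PresentedAlgebra.

Record digraph := Digraph {
  vertex : choiceType;
  arrow : choiceType;
  src : arrow -> vertex;
  tgt : arrow -> vertex
}.

Section Digraphs.
Variable G : digraph.
Implicit Types (v : vertex G) (e f : arrow G) (c d p : seq (arrow G)).

(* [path.cycle] includes the condition tgt (last arrow) = src (first arrow);
   rotations are identified by [cycle_class] below. *)
Definition is_cycle c : bool :=
  [&& c != [::], path.cycle (fun e f => tgt e == src f) c & uniq (map (@src G) c)].

Definition on_path v p : bool := (v \in map (@src G) p) || (v \in map (@tgt G) p).

Definition is_exit e p : bool := (e \notin p) && on_path (src e) p.

Definition no_exit_cycle c : Prop := is_cycle c /\ forall e, ~~ is_exit e c.

Definition cycle_class c : set (seq (arrow G)) :=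
  [set d | exists n, d = rot n c].

End Digraphs.

Definition full_subgraph (G : digraph) (S : set (vertex G)) : digraph :=
  @Digraph {v : vertex G | v \in S}
           {e : arrow G | (src e \in S) && (tgt e \in S)}
           (fun e => exist _ (src (val e)) (proj1 (andP (valP e))))
           (fun e => exist _ (tgt (val e)) (proj2 (andP (valP e)))).

Definition subgraph_path (G : digraph) (S : set (vertex G))
    (p : seq (arrow (full_subgraph S))) : seq (arrow G) := map val p.

Inductive lpa_gen (G : digraph) : Type :=
  | Vert of vertex G
  | Arr of arrow G
  | Ghost of arrow G.

Section Leavitt.
Variables (F : fieldType) (G : digraph).

Local Notation V v := (Gen (Vert v) : expr F (lpa_gen G)).
Local Notation E e := (Gen (Arr e) : expr F (lpa_gen G)).
Local Notation "e '^*'" := (Gen (Ghost e) : expr F (lpa_gen G)).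

(* In lpa_CK2 the list r enumerates the arrows with source v, so that v emits
   a nonzero finite number of arrows. *)
Inductive lpa_rel : expr F (lpa_gen G) -> expr F (lpa_gen G) -> Prop :=
  | lpa_VV (u v : vertex G) :
      lpa_rel (Mul (V u) (V v)) (if u == v then V u else Zero)
  | lpa_sE (e : arrow G) : lpa_rel (Mul (V (src e)) (E e)) (E e)
  | lpa_Et (e : arrow G) : lpa_rel (Mul (E e) (V (tgt e))) (E e)
  | lpa_tG (e : arrow G) : lpa_rel (Mul (V (tgt e)) (e ^*)) (e ^*)
  | lpa_Gs (e : arrow G) : lpa_rel (Mul (e ^*) (V (src e))) (e ^*)
  | lpa_CK1 (e f : arrow G) :
      lpa_rel (Mul (e ^*) (E f)) (if e == f then V (tgt e) else Zero)
  | lpa_CK2 (v : vertex G) (r : seq (arrow G)) :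
      uniq r -> r != [::] -> (forall e, (e \in r) = (src e == v)) ->
      lpa_rel (V v) (foldr (fun e x => Add (Mul (E e) (e ^*)) x) Zero r).

Definition LPA : nuAlgType F := presented lpa_rel.

Definition lpa_vert (v : vertex G) : LPA := pclass lpa_rel (V v).

Lemma lpa_vert_idem v : nmul (lpa_vert v) (lpa_vert v) = lpa_vert v.
Proof.
rewrite [LHS]pmulE; apply/pclassP; apply: congr_rel.
by have := lpa_VV v v; rewrite eqxx.
Qed.

Definition vert_ideal (v : vertex G) : {pred LPA} :=
  fun x => `[< exists a : LPA, x = nmul (lpa_vert v) a >].

Lemma vert_ideal_submod v : submod_closed (vert_ideal v).
Proof.
split=> [|k x y /asboolP[a ->] /asboolP[b ->]]; apply/asboolP.
  exists 0; rewrite -[in RHS](scale0r (0 : LPA)) -nscaleAr scale0r //.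
by exists (k *: a + b); rewrite nmulDr nscaleAr.
Qed.

HB.instance Definition _ v :=
  GRing.isSubmodClosed.Build F LPA (vert_ideal v) (vert_ideal_submod v).

Record vert_module (v : vertex G) := VertModule {
  vert_module_val :> LPA;
  vert_module_valP : vert_module_val \in vert_ideal v
}.

HB.instance Definition _ v := [isSub for @vert_module_val v].
HB.instance Definition _ v := [Choice of vert_module v by <:].
HB.instance Definition _ v :=
  [SubChoice_isSubLmodule of vert_module v by <:].

Section VertModule.
Variable v : vertex G.

Lemma vert_ideal_mul (x : vert_module v) (a : LPA) :
  nmul (val x) a \in vert_ideal v.
Proof.
by have /asboolP[b ->] := valP x; apply/asboolP; exists (nmul b a); rewrite nmulA.
Qed.

Definition vert_act (x : vert_module v) (a : LPA) : vert_module v :=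
  VertModule (vert_ideal_mul x a).

Lemma vert_actDl x y a : vert_act (x + y) a = vert_act x a + vert_act y a.
Proof. by apply: val_inj; rewrite /= nmulDl. Qed.

Lemma vert_actDr x a b : vert_act x (a + b) = vert_act x a + vert_act x b.
Proof. by apply: val_inj; rewrite /= nmulDr. Qed.

Lemma vert_actZl (k : F) x a : vert_act (k *: x) a = k *: vert_act x a.
Proof. by apply: val_inj; rewrite /= nscaleAl. Qed.

Lemma vert_actZr (k : F) x a : vert_act x (k *: a) = k *: vert_act x a.
Proof. by apply: val_inj; rewrite /= nscaleAr. Qed.

Lemma vert_actA x a b : vert_act (vert_act x a) b = vert_act x (nmul a b).
Proof. by apply: val_inj; rewrite /= nmulA. Qed.

Lemma vert_act_unital x :
  exists r : seq (vert_module v * LPA), x = \sum_(p <- r) vert_act p.1 p.2.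
Proof.
have vv : lpa_vert v \in vert_ideal v.
  by apply/asboolP; exists (lpa_vert v); rewrite lpa_vert_idem.
have /asboolP[a xE] := valP x.
exists [:: (VertModule vv, a)]; rewrite big_seq1 /=.
exact: val_inj.
Qed.

HB.instance Definition _ := Lmodule_isRightModule.Build F LPA (vert_module v)
  vert_actDl vert_actDr vert_actZl vert_actZr vert_actA vert_act_unital.

End VertModule.

Definition vL (v : vertex G) : rmodType LPA := vert_module v.

Definition support (M : rmodType LPA) : set (vertex G) :=
  [set v | exists x : M, ract x (lpa_vert v) != 0].

Definition support_subgraph (M : rmodType LPA) : digraph :=
  full_subgraph (support M).

Definition no_exit_cycle_classes : set (set (seq (arrow G))) :=
  [set C | exists2 c, no_exit_cycle c & C = cycle_class c].

Definition nonsimple_fgip_classes : (rmodType LPA -> Prop) -> Prop :=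
  fun I => exists P : rmodType LPA, [/\ fgip P, ~ simple P & I = iso_class P].

End Leavitt.

(* Main.v *)
From HB Require Import structures.
From mathcomp Require Import all_boot all_algebra.
From mathcomp Require Import boolp classical_sets.
From mathcomp Require Import zify.
Require Import Defs.

(* Write P for the module and x^* for the ghost of a path x.

   A nonzero x in vL can be reduced: some ghost path p^* and some b in L make
   p^* x b a vertex, unless p^* x <> 0 for a path p ending on a cycle without
   exit.  A finitely generated projective P has a homomorphism to L that does
   not vanish on a given nonzero element; composing it with left multiplication
   by p^* gives psi : P -> wL, w the end of p.  In the first case w lies in the
   image, so wL splits off P.  In the second case wLw is a ring of Laurent
   polynomials, so the image of psi is gL with g <> 0, which is isomorphic to wL
   by left multiplication by g, and wL again splits off.  As P is
   indecomposable, P = wL.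

   If a path q from w ends at a source of two arrows, one of them e, then the
   idempotent qe(qe)^* decomposes wL.  So no branching is reachable from w: if w
   leads to a cycle without exit, then wL = vL for v on the cycle, and otherwise
   the reduction shows that wL is simple.

   That vertices and polynomials in a cycle are nonzero in L is seen on a module
   of functions on boundary paths, graded by an integer degree. *)

Set Implicit Arguments.
Unset Strict Implicit.
Unset Printing Implicit Defensive.

Import GRing.Theory.
Local Open Scope ring_scope.
Local Open Scope quotient_scope.

(* The monomials [pq^*] serve only as a spanning set, so nonvanishing is always tested in a concrete
   module. There the integer degree is essential: a cycle without exit returns its only boundary
   path to itself, hence all powers of the cycle would act alike without it. [L] need not have a
   unit. Finite sums of vertices act as local units instead, both to map a power of [L] onto [P] and
   to place [a] in [aL]. Both outcomes of the reduction feed one splitting criterion: if the image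
   of [psi] is [psi(x0) L] and left multiplication by [psi(x0)] is injective on [wL], then [P] is
   the direct sum of [x0 L] and the kernel of [psi]. The ring [wLw] is handled through [F[X]]:
   multiplying by a power of the cycle turns an element into a polynomial in the cycle, and domain
   and division arguments take place among polynomials. A module element with arbitrary right end is
   first cut into pieces passing through [w]. The cycle is recovered from the support: for [v] on
   it, [u] supports [vL] exactly when some paths from [v] and [u] meet, and no path leaves a cycle
   without exit. *)
Local Infix "**" := nmul (at level 40, left associativity).

(** * Finite sums and orthogonal idempotent operators *)

Section FiniteSums.
Variable A : zmodType.
Implicit Types x y z : A.

(** Plays the role of a span. Scalars are left to [S], whose members carry their own coefficients,
    so that it also suits families such as the elements fixed by one of several operators. *)
Definition sum_of (S : A -> Prop) x : Prop :=
  exists2 l : seq A, (forall m, m \in l -> S m) & x = \sum_(m <- l) m.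

Lemma sum_of0 (S : A -> Prop) : sum_of S 0.
Proof. by exists [::]; rewrite ?big_nil. Qed.

Lemma sum_of1 (S : A -> Prop) x : S x -> sum_of S x.
Proof. by move=> Sx; exists [:: x]; rewrite ?big_seq1 // => m /[!inE] /eqP->. Qed.

Lemma sum_ofD (S : A -> Prop) x y : sum_of S x -> sum_of S y -> sum_of S (x + y).
Proof.
move=> [l lS ->] [m mS ->]; exists (l ++ m); last by rewrite big_cat.
by move=> u; rewrite mem_cat => /orP[/lS|/mS].
Qed.

Lemma sum_of_sum (S : A -> Prop) I (r : seq I) (f : I -> A) :
  (forall i, sum_of S (f i)) -> sum_of S (\sum_(i <- r) f i).
Proof.
by move=> fS; apply: big_ind => //; [exact: sum_of0 | exact: sum_ofD].
Qed.

Lemma sum_of_ind (S T : A -> Prop) x : T 0 ->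
  (forall m y, S m -> T y -> T (m + y)) -> sum_of S x -> T x.
Proof.
move=> T0 TD [l lS ->]; elim: l lS => [|m l IH] lS; first by rewrite big_nil.
rewrite big_cons; apply: TD; first by apply: lS; rewrite mem_head.
by apply: IH => u ul; apply: lS; rewrite inE ul orbT.
Qed.

Lemma sum_of_morph (S T : A -> Prop) (f : A -> A) x :
  f 0 = 0 -> {morph f : x y / x + y} -> (forall m, S m -> sum_of T (f m)) ->
  sum_of S x -> sum_of T (f x).
Proof.
move=> f0 fD fS; apply: (@sum_of_ind S (fun y => sum_of T (f y))) => [|m y /fS Tm Ty].
  by rewrite f0; exact: sum_of0.
by rewrite fD; exact: sum_ofD.
Qed.

(* For the orthogonal idempotent operators [T j], a sum of elements each fixed
   by one of them is recovered from its images under finitely many of them. *)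
Lemma orth_decomp (J : eqType) (T : J -> A -> A) x :
  (forall j, T j 0 = 0) -> (forall j, {morph T j : y z / y + z}) ->
  (forall i j y, T j (T i y) = if i == j then T i y else 0) ->
  sum_of (fun m => exists j, T j m = m) x ->
  exists2 s : seq J, uniq s & x = \sum_(j <- s) T j x.
Proof.
move=> T0 TD TT [l lT ->].
have [s sl] : exists s : seq J, forall m, m \in l -> exists2 j, j \in s & T j m = m.
  elim: l lT => [|m l IH] lT; first by exists [::].
  have [|s sP] := IH; first by move=> u ul; apply: lT; rewrite inE ul orbT.
  have [j jm] := lT m (mem_head _ _).
  exists (j :: s) => u; rewrite inE => /orP[/eqP->|/sP[i is_ iu]].
    by exists j; rewrite ?mem_head.
  by exists i; rewrite // inE is_ orbT.
exists (undup s); first exact: undup_uniq.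
have Tsum j : T j (\sum_(m <- l) m) = \sum_(m <- l) T j m.
  exact: (big_morph _ (TD j) (T0 j)).
rewrite (eq_bigr _ (fun j _ => Tsum j)) exchange_big /=.
rewrite [LHS]big_seq [RHS]big_seq; apply: eq_bigr => m /sl[j js jm].
rewrite (bigD1_seq j) ?mem_undup ?undup_uniq //= jm.
rewrite big1 ?addr0 // => i ij.
by rewrite -jm TT eq_sym (negPf ij).
Qed.

Lemma orth_nonzero (J : eqType) (T : J -> A -> A) x :
  (forall j, T j 0 = 0) -> (forall j, {morph T j : y z / y + z}) ->
  (forall i j y, T j (T i y) = if i == j then T i y else 0) ->
  sum_of (fun m => exists j, T j m = m) x -> x != 0 ->
  exists j, T j x != 0.
Proof.
move=> T0 TD TT Tx; apply: contra_neqP => nT.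
have [s _ ->] := orth_decomp T0 TD TT Tx.
by rewrite big1 // => j _; apply/eqP/negP => /negP Tj; apply: nT; exists j.
Qed.

End FiniteSums.

Section NuAlgebraTheory.
Variables (F : fieldType) (A : nuAlgType F).
Implicit Types x y z : A.

Lemma nmul0l x : 0 ** x = 0.
Proof. by have := nscaleAl (0 : F) 0 x; rewrite !scale0r => <-. Qed.

Lemma nmul0r x : x ** 0 = 0.
Proof. by have := nscaleAr (0 : F) x 0; rewrite !scale0r => <-. Qed.

Lemma nmulNl x y : (- x) ** y = - (x ** y).
Proof. by rewrite -scaleN1r -nscaleAl scaleN1r. Qed.

Lemma nmulNr x y : x ** (- y) = - (x ** y).
Proof. by rewrite -scaleN1r -nscaleAr scaleN1r. Qed.

Lemma nmulBl x y z : (x - y) ** z = x ** z - y ** z.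
Proof. by rewrite nmulDl nmulNl. Qed.

Lemma nmulBr x y z : z ** (x - y) = z ** x - z ** y.
Proof. by rewrite nmulDr nmulNr. Qed.

Lemma nmul_suml I (r : seq I) (P : pred I) (f : I -> A) y :
  (\sum_(i <- r | P i) f i) ** y = \sum_(i <- r | P i) f i ** y.
Proof. by apply: (big_morph (fun x => x ** y)) => [x z|]; rewrite ?nmulDl ?nmul0l. Qed.

Lemma nmul_sumr I (r : seq I) (P : pred I) (f : I -> A) y :
  y ** (\sum_(i <- r | P i) f i) = \sum_(i <- r | P i) y ** f i.
Proof. by apply: (big_morph (fun x => y ** x)) => [x z|]; rewrite ?nmulDr ?nmul0r. Qed.

Lemma sum_of_mull (S T : A -> Prop) a x :
  (forall m, S m -> sum_of T (a ** m)) -> sum_of S x -> sum_of T (a ** x).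
Proof.
by move=> aS; apply: (@sum_of_morph _ S T (nmul a)) => // [|? ?];
  rewrite ?nmul0r ?nmulDr.
Qed.

Lemma sum_of_mulr (S T : A -> Prop) a x :
  (forall m, S m -> sum_of T (m ** a)) -> sum_of S x -> sum_of T (x ** a).
Proof.
by move=> aS; apply: (@sum_of_morph _ S T (fun y => y ** a)) => // [|? ?];
  rewrite ?nmul0l ?nmulDl.
Qed.

Lemma sum_of_sub (S T : A -> Prop) x :
  (forall m, S m -> sum_of T m) -> sum_of S x -> sum_of T x.
Proof. by move=> ST; apply: (@sum_of_morph _ S T id). Qed.

End NuAlgebraTheory.

(** * Paths and cycles without exit *)

Section Paths.
Variable G : digraph.
Implicit Types (v w : vertex G) (e f : arrow G) (p q c : seq (arrow G)).

Fixpoint is_path v p : bool :=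
  if p is e :: p' then (src e == v) && is_path (tgt e) p' else true.

Definition pend v p : vertex G := last v (map (@tgt G) p).

Lemma pend_cat v p q : pend v (p ++ q) = pend (pend v p) q.
Proof. by rewrite /pend map_cat last_cat. Qed.

Lemma pend_rcons v p e : pend v (rcons p e) = tgt e.
Proof. by rewrite /pend map_rcons last_rcons. Qed.

Lemma is_path_cat v p q : is_path v (p ++ q) = is_path v p && is_path (pend v p) q.
Proof. by elim: p v => //= e p IH v; rewrite IH andbA. Qed.

Lemma is_path_rcons v p e : is_path v (rcons p e) = is_path v p && (src e == pend v p).
Proof. by rewrite -cats1 is_path_cat /= andbT. Qed.

Definition from_cycle c v : Prop :=
  exists e p, [/\ c = e :: p, src e = v, is_path v c, pend v c = v &
    uniq (map (@src G) c)].

(** Quantifying over the arrows of [c] makes this inherited by every part of [c], as the shortening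
    of closed paths requires. On a closed path with repeated vertices it is stronger than the
    absence of [is_exit] arrows: a figure eight branches on itself. *)
Definition no_exit c : Prop := forall e f, e \in c -> src f = src e -> f = e.

Definition on_cycle v : Prop :=
  exists2 c, from_cycle c v & no_exit c.

Lemma path_tgt_src e p :
  path (fun e f => tgt e == src f) e p = is_path (tgt e) p.
Proof. by elim: p e => //= f p IH e; rewrite IH eq_sym. Qed.

Lemma is_cycleP c : is_cycle c -> exists v, from_cycle c v.
Proof.
case: c => [//|e p] /and3P[_]; rewrite /path.cycle path_tgt_src is_path_rcons.
move=> /andP[pp /eqP pe] up; exists (src e), e, p; split=> //=.
by rewrite eqxx.
Qed.

Lemma from_cycle_is_cycle c v : from_cycle c v -> is_cycle c.
Proof.
move=> [e [p [-> <- /= /andP[_ pp] pe up]]]; apply/and3P; split=> //.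
rewrite /path.cycle path_tgt_src is_path_rcons pp /=.
by apply/eqP; rewrite -[LHS]pe.
Qed.

Lemma from_cycle_tgt c v e : from_cycle c v -> e \in c -> tgt e \in map (@src G) c.
Proof.
move=> [g [p [-> <- /andP[_ pp] pe _]]].
move=> /splitPr; case E : _ / => [p1 p2].
have : is_path (src g) (g :: p) by rewrite /= eqxx.
move: pe; rewrite E is_path_cat pend_cat.
case: p2 E => [|f p2] E /=.
  rewrite {1}/pend /= => -> _.
  by case: p1 E => [|f p1] [-> _] /=; rewrite ?mem_head.
move=> _ /andP[_ /andP[_ /andP[/eqP <- _]]].
by rewrite map_cat /= mem_cat !inE eqxx !orbT.
Qed.

Lemma on_cycle_src c v : is_cycle c -> on_path v c = (v \in map (@src G) c).
Proof.
move=> /is_cycleP[w wc]; rewrite /on_path; case: (boolP (v \in _)) => //= nv.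
apply/negbTE/negP => /mapP[e ec ve]; move: nv.
by rewrite ve (from_cycle_tgt wc ec).
Qed.

(** Distinct sources make the two forms agree on a cycle: an arrow of [c] with the source of [e] has
    the index of [e]. *)
Lemma no_exitP c : is_cycle c -> no_exit c <-> forall e, ~~ is_exit e c.
Proof.
move=> cc; split=> [ne f|ne e f ec fe].
  apply/negP => /andP[/negP nf]; rewrite on_cycle_src // => /mapP[e ec fe].
  by apply: nf; rewrite (ne e f ec fe).
have fc : f \in c.
  have := ne f; rewrite /is_exit on_cycle_src // fe map_f // andbT.
  by rewrite negbK.
have /and3P[_ _ u] := cc; apply/eqP.
by move: fe => /eqP; rewrite -[f](nth_index e fc) -{2}[e](nth_index e ec);
  rewrite -!(nth_map _ (src e)) ?index_mem // nth_uniq ?size_map ?index_mem //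
  => /eqP ->; rewrite nth_index.
Qed.

Lemma from_cycle_rot c v u : from_cycle c v -> u \in map (@src G) c ->
  exists n, from_cycle (rot n c) u.
Proof.
move=> [g [p [-> <- pc pe up]]] /mapP[e ec ->].
move: ec pc pe up => /splitPr; case E : _ / => [p1 p2] pc pe up.
exists (size p1); rewrite rot_size_cat.
move: pc pe up; rewrite is_path_cat pend_cat map_cat => /andP[p1p].
rewrite /= => /andP[/eqP se p2p] pe up; exists e, (p2 ++ p1); split=> //.
- have pe2 : pend (tgt e) p2 = src g by rewrite -[RHS]pe.
  by rewrite /= is_path_cat eqxx p2p pe2.
- have pe2 : pend (src e) (e :: p2) = src g by rewrite -[RHS]pe.
  by rewrite -cat_cons pend_cat pe2.
by rewrite -cat_cons map_cat uniq_catC.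
Qed.

Lemma on_cycleP v :
  on_cycle v <-> exists c, no_exit_cycle c /\ on_path v c.
Proof.
split=> [[c vc ne]|[c [[cc ne] vc]]].
  have cc := from_cycle_is_cycle vc.
  exists c; split; first by split=> //; apply/no_exitP.
  by rewrite on_cycle_src //; case: vc => e [p [-> <- _ _ _]]; rewrite mem_head.
have /is_cycleP[w wc] := cc.
move: vc; rewrite on_cycle_src // => /(from_cycle_rot wc)[n vn].
exists (rot n c) => // e f; rewrite mem_rot.
by move/no_exitP: ne; apply.
Qed.

(* Cutting out the part between two arrows with the same source shortens a
   closed path until it is a cycle. *)
Lemma closed_path_on_cycle v c : c != [::] -> is_path v c -> pend v c = v ->
  no_exit c -> on_cycle v.
Proof.
have [n] := ubnP (size c); elim: n c => // n IH c /ltnSE sc c0 pc ce ne.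
case: (boolP (uniq (map (@src G) c))) => [uc|/(uniqPn v)[i [j [ij js eq_ij]]]].
  exists c => //; case: c c0 pc ce uc {sc IH ne} => [//|e p] _ pc pe uc.
  by exists e, p; split=> //; case/andP: pc => /eqP.
rewrite size_map in js.
have e0 : arrow G by case: (c) c0 => [|e].
have is_ : (i < size c)%N by exact: ltn_trans js.
rewrite !(nth_map e0) // in eq_ij.
have := pc; rewrite -{1}(cat_take_drop j c) is_path_cat => /andP[pj pdj].
have := pc; rewrite -{1}(cat_take_drop i c) is_path_cat => /andP[pi pdi].
have endij : pend v (take i c) = pend v (take j c).
  move: pdj pdi; rewrite (drop_nth e0 js) (drop_nth e0 is_) /=.
  by move=> /andP[/eqP <- _] /andP[/eqP <- _].
apply: (IH (take i c ++ drop j c)).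
- by rewrite size_cat size_take size_drop is_; apply: leq_trans sc; move: ij js; lia.
- by rewrite -size_eq0 size_cat size_drop addn_eq0 subn_eq0 leqNgt js andbF.
- by rewrite is_path_cat pi endij.
- by rewrite pend_cat endij -pend_cat cat_take_drop.
move=> e f; rewrite mem_cat => ee; apply: ne.
by case/orP: ee => [/mem_take|/mem_drop].
Qed.

Lemma on_cycle_unique v e f : on_cycle v -> src e = v -> src f = v -> f = e.
Proof.
case=> c [g [p [cE gv _ _ _]]] ne ev fv.
have gc : g \in c by rewrite cE mem_head.
by rewrite (ne g e gc) ?ev // (ne g f gc) ?fv.
Qed.

Lemma on_cycle_tgt e : on_cycle (src e) -> on_cycle (tgt e).
Proof.
move=> vC; have [c vc ne] := vC.
have ec : e \in c.
  have [g [p [cE gv _ _ _]]] := vc.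
  by rewrite (on_cycle_unique vC gv (erefl _)) cE mem_head.
have [n nc] := from_cycle_rot vc (from_cycle_tgt vc ec).
by exists (rot n c) => // g f; rewrite mem_rot; exact: ne.
Qed.

Lemma on_cycle_pend v p : on_cycle v -> is_path v p -> on_cycle (pend v p).
Proof.
elim: p v => //= e p IH v vC /andP[/eqP ev pp]; apply: IH pp.
by apply: on_cycle_tgt; rewrite ev.
Qed.

(** This is what indecomposability of [vL F v] yields. It still allows paths that stop at a sink or
    run on forever without repetition; those give the simple modules. *)
Definition unbranched v : Prop := forall p e f, is_path v p ->
  src e = pend v p -> src f = pend v p -> e = f.

Lemma unbranched_pend v p : unbranched v -> is_path v p -> unbranched (pend v p).
Proof.
move=> vU pp q e f pq; rewrite -pend_cat; apply: vU.
by rewrite is_path_cat pp.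
Qed.

Lemma on_cycle_unbranched v : on_cycle v -> unbranched v.
Proof.
by move=> vC p e f /(on_cycle_pend vC) pC ev fv; exact: on_cycle_unique fv ev.
Qed.

Lemma on_cycle_prefix v p q : on_cycle v -> is_path v p -> is_path v q ->
  (size p <= size q)%N -> exists r, q = p ++ r.
Proof.
elim: p v q => [|e p IH] v q vC /=; first by exists q.
move=> /andP[/eqP ev pp]; case: q => //= f q /andP[/eqP fv pq] spq.
have ef := on_cycle_unique vC ev fv; subst f.
have [|r ->] := IH (tgt e) q _ pp pq spq; last by exists r.
by apply: on_cycle_tgt; rewrite ev.
Qed.

Lemma on_cycle_return v p : on_cycle v -> is_path v p ->
  exists r, is_path (pend v p) r /\ pend (pend v p) r = v.
Proof.
move=> vC; elim/last_ind: p => [|p e IH]; first by exists [::].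
rewrite is_path_rcons pend_rcons => /andP[/[dup] pp /IH[r [pr re]] /eqP ev].
have uC := on_cycle_pend vC pp.
case: r pr re => [_|f r /= /andP[/eqP fu pr] re]; last first.
  by have <- := on_cycle_unique uC ev fu; exists r.
rewrite {1}/pend /= => ve.
have [c [f [q [cE fv]]]] := vC; rewrite cE /= => /andP[_ pq] qe _ _.
have <- : f = e by apply: on_cycle_unique uC ev _; rewrite ve.
by exists q.
Qed.

Lemma cycle_prefix_closed v c p : from_cycle c v -> no_exit c ->
  is_path v p -> pend v p = v -> p != [::] -> exists r, p = c ++ r.
Proof.
move=> vc ne pp pe p0.
have vC : on_cycle v by exists c.
have [e [q [cE ev pc ce uc]]] := vc.
have [cp|/ltnW pc'] := leqP (size c) (size p).
  exact: on_cycle_prefix vC pc pp cp.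
have [r cpr] := on_cycle_prefix vC pp pc pc'.
(* If [p] were a proper prefix of [c], the next arrow of [c] would start at [v] again, against the
   distinct sources. *)
case: r cpr => [|f r] cpr; first by exists [::]; rewrite cpr !cats0.
move: pc; rewrite cpr is_path_cat pe /= => /and3P[_ /eqP fv _].
move: uc; rewrite cpr; case: p p0 {pp pe pc'} cpr => // g p _.
rewrite cE => -[<- _]; rewrite map_cat /= ev mem_cat negb_or inE fv eqxx.
by rewrite andbF.
Qed.

Lemma closed_path_power v c p : from_cycle c v -> no_exit c ->
  is_path v p -> pend v p = v -> exists i, p = flatten (nseq i c).
Proof.
move=> vc ne; have [n] := ubnP (size p); elim: n p => // n IH p /ltnSE sp pp pe.
have [->|p0] := eqVneq p [::]; first by exists 0%N.
have [r pr] := cycle_prefix_closed vc ne pp pe p0.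
have [e [q [cE ev pc ce uc]]] := vc.
move: pp pe; rewrite pr is_path_cat pend_cat ce => /andP[_ rp] re.
have [|i ->] := IH r _ rp re; last by exists i.+1.
by apply: leq_trans sp; rewrite pr size_cat cE /= addSn ltnS leq_addl.
Qed.

Lemma from_cycle_eq v c d : from_cycle c v -> no_exit c ->
  from_cycle d v -> no_exit d -> c = d.
Proof.
move=> vc nc vd nd.
have [e [q [cE ev pc ce uc]]] := vc; have [e' [q' [dE ev' pd de ud]]] := vd.
have [|r dr] := cycle_prefix_closed vc nc pd de; first by rewrite dE.
have [|r' cr] := cycle_prefix_closed vd nd pc ce; first by rewrite cE.
have /eqP := congr1 size cr; rewrite dr !size_cat -addnA -{1}[size c]addn0.
rewrite eqn_add2l eq_sym addn_eq0 size_eq0 => /andP[/eqP r0 _].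
by rewrite r0 cats0.
Qed.

Lemma cycle_classP c d :
  (cycle_class c = cycle_class d) <-> exists n, d = rot n c.
Proof.
have rotI n (s : seq (arrow G)) : exists m, s = rot m (rot n s).
  by exists (size s - n)%N; rewrite -[in LHS](rotK n s) /rotr size_rot.
have rotA m n (s : seq (arrow G)) : exists k, rot m (rot n s) = rot k s.
  have [sn|ns] := leqP (size s) n; first by exists m; rewrite (rot_oversize sn).
  have [sm|ms] := leqP (size s) m.
    by exists n; rewrite rot_oversize ?size_rot.
  by eexists; rewrite rot_add_mod //; exact: ltnW.
split=> [cd|[n ->]].
  have : cycle_class d d by exists 0%N; rewrite rot0.
  by rewrite -cd.
apply: classical_sets.eq_set => s; apply: propext; split=> -[m ->].
  have [k ck] := rotI n c; rewrite {1}ck.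
  by have [j ->] := rotA m k (rot n c); exists j.
by have [j ->] := rotA m n c; exists j.
Qed.

Lemma from_cycle_pend c v p : from_cycle c v -> no_exit c -> is_path v p ->
  pend v p \in map (@src G) c.
Proof.
move=> vc cn; elim/last_ind: p => [_|p e IH].
  by case: vc => e [q [-> <- _ _ _]]; exact: mem_head.
rewrite is_path_rcons pend_rcons => /andP[/IH/mapP[f fc fe] /eqP].
by rewrite fe => /(cn f e fc) ->; exact: from_cycle_tgt vc fc.
Qed.

Lemma from_cycle_path c v u : from_cycle c v -> u \in map (@src G) c ->
  exists2 p, is_path v p & pend v p = u.
Proof.
move=> [e0 [q [_ _ pc _ _]]] /mapP[e /splitPr ec ->]; case: ec pc => p1 p2.
by rewrite is_path_cat /= => /and3P[pp /eqP -> _]; exists p1.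
Qed.

Lemma no_exit_cycle_rot c v : no_exit_cycle c -> on_path v c ->
  exists2 n, from_cycle (rot n c) v & no_exit (rot n c).
Proof.
move=> [cc cn]; rewrite on_cycle_src // => vc; have /is_cycleP[w wc] := cc.
have [n nc] := from_cycle_rot wc vc; exists n => // e f; rewrite mem_rot.
by move/no_exitP: cn; apply.
Qed.

Lemma no_exit_cycle_pend c v p : no_exit_cycle c -> on_path v c -> is_path v p ->
  on_path (pend v p) c.
Proof.
move=> cn vc pp; have [n nc ne] := no_exit_cycle_rot cn vc.
have := from_cycle_pend nc ne pp; rewrite on_cycle_src; last by case: cn.
by rewrite map_rot mem_rot.
Qed.

(** A path cannot leave [c], so its end lies on both cycles; read from that vertex, each is a prefix
    of the other. *)
Lemma no_exit_cycle_meet c d v p : no_exit_cycle c -> no_exit_cycle d ->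
  on_path v c -> is_path v p -> on_path (pend v p) d ->
  cycle_class c = cycle_class d.
Proof.
move=> cn dn vc pp ud; have uc := no_exit_cycle_pend cn vc pp.
have [n nc nne] := no_exit_cycle_rot cn uc; have [m md mne] := no_exit_cycle_rot dn ud.
transitivity (cycle_class (rot n c)); first by apply/cycle_classP; exists n.
by rewrite (from_cycle_eq nc nne md mne); apply/esym/cycle_classP; exists m.
Qed.

End Paths.

(** * The representation on boundary paths *)

Section BoundaryPaths.
Variables (F : fieldType) (G : digraph).
Local Notation L := (LPA F G).
Local Notation X := (lpa_gen G).
Implicit Types (v w : vertex G) (e f : arrow G) (p q : seq (arrow G)).

Definition regular v : Prop :=
  exists r : seq (arrow G), [/\ uniq r, r != [::] & forall e, (e \in r) = (src e == v)].

(* A boundary path is an infinite path, or a finite path ending at a vertex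
   that is not regular, padded by [None] at that vertex. *)
Definition walk := nat -> vertex G * option (arrow G).

Definition boundary (b : walk) : Prop := forall i,
  if (b i).2 is Some e then src e = (b i).1 /\ (b i.+1).1 = tgt e
  else b i.+1 = b i /\ ~ regular (b i).1.

Definition wcons e (b : walk) : walk :=
  fun i => if i is j.+1 then b j else (src e, Some e).

Definition wbehead (b : walk) : walk := fun i => b i.+1.

Lemma boundary_wcons e b : boundary b -> (b 0%N).1 = tgt e -> boundary (wcons e b).
Proof. by move=> bb be [|i] //; exact: bb. Qed.

Lemma boundary_wbehead b : boundary b -> boundary (wbehead b).
Proof. by move=> bb i; exact: bb. Qed.

Lemma wconsK e : cancel (wcons e) wbehead.
Proof. by []. Qed.

Lemma wbeheadK e b : boundary b -> (b 0%N).2 = Some e -> wcons e (wbehead b) = b.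
Proof.
move=> /(_ 0%N) + be; rewrite be => -[se _].
apply: funext => -[|i] //=; by rewrite [b 0%N]surjective_pairing be se.
Qed.

Lemma wbehead_src e b : boundary b -> (b 0%N).2 = Some e -> (wbehead b 0%N).1 = tgt e.
Proof. by move=> /(_ 0%N) + be; rewrite be => -[]. Qed.

Lemma boundary_src e b : boundary b -> (b 0%N).2 = Some e -> (b 0%N).1 = src e.
Proof. by move=> /(_ 0%N) + be; rewrite be => -[->]. Qed.

Lemma boundary_regular b : boundary b -> regular (b 0%N).1 ->
  exists2 e, (b 0%N).2 = Some e & src e = (b 0%N).1.
Proof.
move=> /(_ 0%N); case: (b 0%N).2 => [e [se _] _|[_ nr] /nr //].
by exists e.
Qed.

(* The integer argument is a degree, which arrows raise and ghost arrows lower. *)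
Definition wfun := walk -> int -> F.

(** On point masses this is a right action: [e] deletes a leading [e] from a boundary path, and its
    ghost puts one in front. The tests for [boundary] force the value 0 at all other walks, so that
    the relations hold at every walk. *)
Definition act_gen (x : X) (h : wfun) : wfun := fun b n =>
  match x with
  | Vert v => if `[< boundary b >] && ((b 0%N).1 == v) then h b n else 0
  | Arr e => if `[< boundary b >] && ((b 0%N).1 == tgt e)
             then h (wcons e b) (n - 1) else 0
  | Ghost e => if `[< boundary b >] && ((b 0%N).2 == Some e)
               then h (wbehead b) (n + 1) else 0
  end.

Fixpoint act (x : expr F X) (h : wfun) : wfun :=
  match x with
  | Gen g => act_gen g h
  | Zero => fun _ _ => 0
  | Add x y => fun b n => act x h b n + act y h b n
  | Scale k x => fun b n => k * act x h b n
  | Mul x y => act y (act x h)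
  end.

(** The congruence allows sums and multiples in the left factor of a product. As that factor acts
    first, the right factor must act linearly. *)
Lemma act_lin x k (h h' : wfun) :
  act x (fun b n => k * h b n + h' b n) =
  fun b n => k * act x h b n + act x h' b n.
Proof.
elim: x h h' => [[v|e|e]||x IHx y IHy|l x IH|x IHx y IHy] h h';
  apply: funext => b; apply: funext => n /=.
- by case: ifP; rewrite ?mulr0 ?addr0.
- by case: ifP; rewrite ?mulr0 ?addr0.
- by case: ifP; rewrite ?mulr0 ?addr0.
- by rewrite mulr0 addr0.
- by rewrite IHx IHy mulrDr addrACA.
- by rewrite IH mulrDr !mulrA [l * k]mulrC.
- by rewrite IHx IHy.
Qed.

Lemma act0 x : act x (fun _ _ => 0) = fun _ _ => 0.
Proof.
have := act_lin x (-1) (fun _ _ => 0) (fun _ _ => 0).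
have -> : (fun (b : walk) (n : int) => -1 * 0 + 0 : F) = (fun _ _ => 0).
  by apply: funext => b; apply: funext => n; rewrite mulr0 addr0.
move=> E; apply: funext => b; apply: funext => n.
by move: (congr1 (fun h : wfun => h b n) E); rewrite mulN1r addNr.
Qed.

Lemma actD x (h h' : wfun) :
  act x (fun b n => h b n + h' b n) = fun b n => act x h b n + act x h' b n.
Proof.
have := act_lin x 1 h h'.
have -> : (fun (b : walk) (n : int) => 1 * h b n + h' b n) = (fun b n => h b n + h' b n).
  by apply: funext => b; apply: funext => n; rewrite mul1r.
by move=> ->; apply: funext => b; apply: funext => n; rewrite mul1r.
Qed.

Lemma actZ x k (h : wfun) :
  act x (fun b n => k * h b n) = fun b n => k * act x h b n.
Proof.
have := act_lin x k h (fun _ _ => 0).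
have -> : (fun (b : walk) (n : int) => k * h b n + 0) = (fun b n => k * h b n).
  by apply: funext => b; apply: funext => n; rewrite addr0.
by move=> ->; apply: funext => b; apply: funext => n; rewrite act0 addr0.
Qed.

Lemma act_rel x y : @lpa_rel F G x y -> act x = act y.
Proof.
move=> xy; apply: funext => h; apply: funext => b; apply: funext => n.
case: xy => [u v|e|e|e|e|e f|v r ur r0 rv] /=.
- case: (eqVneq u v) => [<-|uv] /=; first by case: (_ && _).
  by case: ifP => // /andP[_ /eqP->]; rewrite [v == u]eq_sym (negPf uv) andbF.
- case: ifP => // /andP[/asboolP bb /eqP be].
  by rewrite (asboolT (boundary_wcons bb be)) /= eqxx.
- by case: (_ && _).
- case: ifP => // /andP[/asboolP bb /eqP be].
  by rewrite (asboolT (boundary_wbehead bb)) (wbehead_src bb be) eqxx.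
- case: (asboolP (boundary b)) => //= bb; case: ifP => /eqP // bs; case: ifP => // /eqP be.
  by case: bs; rewrite (boundary_src bb be).
- case: (eqVneq e f) => [<-|ef] /=; last first.
    case: ifP => // _; case: ifP => // /andP[_ /eqP[fe]].
    by rewrite fe eqxx in ef.
  case: ifP => // /andP[/asboolP bb /eqP be].
  by rewrite (asboolT (boundary_wcons bb be)) eqxx /= wconsK subrK.
- have -> : act (foldr (fun e x => Add (Mul (Gen (Arr e)) (Gen (Ghost e))) x) Zero r) h b n
          = \sum_(e <- r) act_gen (Ghost e) (act_gen (Arr e) h) b n.
    by elim: r {ur r0 rv} => [|e r IH] /=; rewrite ?big_nil ?big_cons ?IH.
  case: (asboolP (boundary b)) => bb /=; last first.
    by rewrite big1 // => e _; case: ifP => // /andP[/asboolP /bb].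
  have rb (bv : (b 0%N).1 = v) : regular (b 0%N).1 by exists r; rewrite bv.
  have -> : \sum_(e <- r) (if `[< boundary b >] && ((b 0%N).2 == Some e)
       then if `[< boundary (wbehead b) >] && ((wbehead b 0%N).1 == tgt e)
            then h (wcons e (wbehead b)) (n + 1 - 1) else 0 else 0)
      = \sum_(e <- r) (if (b 0%N).2 == Some e then h b n else 0).
    apply: eq_bigr => e _; rewrite asboolT //=; case: ifP => // /eqP be.
    rewrite (asboolT (boundary_wbehead bb)) (wbehead_src bb be) eqxx /=.
    by rewrite wbeheadK // addrK.
  (* A boundary path cannot stop at a regular vertex, so it has a first arrow, and exactly that
     arrow contributes to the sum in CK2. *)
  case: eqP => [bv|bv].
    have [e be se] := boundary_regular bb (rb bv).
    rewrite (bigD1_seq e) //= ?be ?eqxx ?rv ?se ?bv ?eqxx //=.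
    by rewrite big1 ?addr0 // => f fe; case: eqP => // -[ef]; rewrite ef eqxx in fe.
  rewrite big_seq big1 // => e; rewrite rv => /eqP ev; case: eqP => // be.
  by case: bv; rewrite (boundary_src bb be).
Qed.

Lemma act_congr x y : congr (@lpa_rel F G) x y -> act x = act y.
Proof.
elim=> {x y} /=.
- exact: act_rel.
- by [].
- by move=> x y _ ->.
- by move=> x y z _ -> _ ->.
- by move=> x x' y y' _ -> _ ->.
- by move=> k x x' _ ->.
- by move=> x x' y y' _ -> _ ->.
all: move=> *; apply: funext => h; apply: funext => b; apply: funext => n /=.
- by rewrite addrA.
- by rewrite addrC.
- by rewrite add0r.
- by rewrite mul0r.
- by rewrite mul1r.
- by rewrite mulrA.
- by rewrite mulrDl.
- by rewrite mulrDr.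
- by [].
- by rewrite actD.
- by [].
- by rewrite actZ.
- by [].
Qed.

Definition lact (x : L) : wfun -> wfun := act (repr x).

Lemma lact_class x : lact (pclass _ x) = act x.
Proof. by apply: act_congr; exact: repr_pclass. Qed.

Lemma lactM x y h : lact (x ** y) h = lact y (lact x h).
Proof.
elim/pclass_ind: x => x; elim/pclass_ind: y => y.
by rewrite [_ ** _]pmulE !lact_class.
Qed.

Lemma lactD x y h b n : lact (x + y) h b n = lact x h b n + lact y h b n.
Proof.
elim/pclass_ind: x => x; elim/pclass_ind: y => y.
by rewrite [_ + _]paddE !lact_class.
Qed.

Lemma lactZ k x h b n : lact (k *: x) h b n = k * lact x h b n.
Proof. by elim/pclass_ind: x => x; rewrite [_ *: _]pscaleE !lact_class. Qed.

Lemma lact0 h b n : lact 0 h b n = 0.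
Proof. by rewrite -(scale0r (0 : L)) lactZ mul0r. Qed.

Lemma lact_sum I (r : seq I) (f : I -> L) h b n :
  lact (\sum_(i <- r) f i) h b n = \sum_(i <- r) lact (f i) h b n.
Proof.
elim: r => [|i r IH]; first by rewrite !big_nil lact0.
by rewrite !big_cons lactD IH.
Qed.

Definition first_arrow v : option (arrow G) :=
  if pselect (exists e, src e = v) is left ex then Some (projT1 (cid ex)) else None.

Lemma first_arrowP v :
  if first_arrow v is Some e then src e = v else forall e, src e <> v.
Proof.
rewrite /first_arrow; case: pselect => [ex|nex]; first by case: cid.
by move=> e ev; apply: nex; exists e.
Qed.

Definition next_vertex v : vertex G :=
  if first_arrow v is Some e then tgt e else v.

(** Supplies a boundary path from every vertex: it stops only at sinks, which are not regular. From
    a vertex on a cycle without exit it winds around the cycle forever. *)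
Definition greedy_walk v : walk :=
  fun i => (iter i next_vertex v, first_arrow (iter i next_vertex v)).

Lemma boundary_greedy v : boundary (greedy_walk v).
Proof.
move=> i; rewrite /greedy_walk /= /next_vertex.
have := first_arrowP (iter i next_vertex v).
case E: (first_arrow _) => [e|] ev //.
split; first by rewrite E.
case=> -[|e r] [_ //= _ /(_ e)]; rewrite mem_head => /esym /eqP.
exact: ev.
Qed.

Lemma wbehead_greedy v : wbehead (greedy_walk v) = greedy_walk (next_vertex v).
Proof. by apply: funext => i; rewrite /wbehead /greedy_walk iterSr. Qed.

(** The constant function 1 still has value 1 at a boundary path from [v] after [v] has acted. *)
Lemma lpa_vert_neq0 v : lpa_vert F v != 0.
Proof.
apply/eqP => v0; have := lact0 (fun _ _ => 1) (greedy_walk v) 0.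
rewrite -v0 lact_class /= asboolT ?eqxx; last exact: boundary_greedy.
by move/eqP; rewrite oner_eq0.
Qed.

Definition point_mass (b0 : walk) (n0 : int) : wfun :=
  fun b n => if `[< b = b0 >] && (n == n0) then 1 else 0.

Lemma lact_vert_mass v n :
  lact (lpa_vert F v) (point_mass (greedy_walk v) n) = point_mass (greedy_walk v) n.
Proof.
rewrite lact_class; apply: funext => b; apply: funext => m /=.
case: ifPn => // nb; rewrite /point_mass; case: asboolP => //= bE.
by move: nb; rewrite bE eqxx andbT asboolT //; exact: boundary_greedy.
Qed.

Lemma lact_arrow_mass v e n : first_arrow v = Some e ->
  lact (pclass _ (Gen (Arr e))) (point_mass (greedy_walk v) n)
  = point_mass (greedy_walk (tgt e)) (n + 1).
Proof.
move=> ve; rewrite lact_class; apply: funext => b; apply: funext => m /=.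
have nv : next_vertex v = tgt e by rewrite /next_vertex ve.
have cE : wcons e (greedy_walk (tgt e)) = greedy_walk v.
  by rewrite -nv -wbehead_greedy wbeheadK //; exact: boundary_greedy.
rewrite /point_mass subr_eq; case: (asboolP (b = _)) => [->|nb].
  by rewrite asboolT ?eqxx /= ?asboolT ?cE //; exact: boundary_greedy.
case: ifP => // /andP[_ _]; rewrite asboolF // => bE; case: nb.
by rewrite -[b](wconsK e) bE wbehead_greedy nv.
Qed.

End BoundaryPaths.

(** * Reduction of elements *)

Section PathElements.
Variables (F : fieldType) (G : digraph).
Local Notation L := (LPA F G).
Implicit Types (v w : vertex G) (e f : arrow G) (p q : seq (arrow G)) (x y z : L).

Definition lpa_arr e : L := pclass _ (Gen (Arr e)).
Definition lpa_ghost e : L := pclass _ (Gen (Ghost e)).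

Local Notation V := (lpa_vert F).
Local Notation E := lpa_arr.
Local Notation E' := lpa_ghost.

Lemma pclass_mul s t :
  pclass (@lpa_rel F G) (Mul s t) = (pclass _ s : L) ** (pclass _ t : L).
Proof. by apply/esym; exact: pmulE. Qed.

Lemma pclass_add s t :
  pclass (@lpa_rel F G) (Add s t) = (pclass _ s : L) + (pclass _ t : L).
Proof. by apply/esym; exact: paddE. Qed.

Lemma pclass_scale k s :
  pclass (@lpa_rel F G) (Scale k s) = k *: (pclass _ s : L).
Proof. by apply/esym; exact: pscaleE. Qed.

Lemma pclass0 : pclass (@lpa_rel F G) Zero = 0 :> L.
Proof. by []. Qed.

Lemma vertM u v : V u ** V v = if u == v then V u else 0.
Proof.
rewrite -pclass_mul; have /congr_rel/pclassP -> := @lpa_VV F G u v.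
by case: ifP.
Qed.

Lemma vert_idem v : V v ** V v = V v.
Proof. by rewrite vertM eqxx. Qed.

Lemma src_arr e : V (src e) ** E e = E e.
Proof. by rewrite -pclass_mul; apply/pclassP/congr_rel; exact: lpa_sE. Qed.

Lemma arr_tgt e : E e ** V (tgt e) = E e.
Proof. by rewrite -pclass_mul; apply/pclassP/congr_rel; exact: lpa_Et. Qed.

Lemma tgt_ghost e : V (tgt e) ** E' e = E' e.
Proof. by rewrite -pclass_mul; apply/pclassP/congr_rel; exact: lpa_tG. Qed.

Lemma ghost_src e : E' e ** V (src e) = E' e.
Proof. by rewrite -pclass_mul; apply/pclassP/congr_rel; exact: lpa_Gs. Qed.

Lemma ghost_arr e f : E' e ** E f = if e == f then V (tgt e) else 0.
Proof.
rewrite -pclass_mul; have /congr_rel/pclassP -> := @lpa_CK1 F G e f.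
by case: ifP.
Qed.

Lemma vert_arr v e : V v ** E e = if v == src e then E e else 0.
Proof.
rewrite -src_arr nmulA vertM; case: eqP => [->//|_]; exact: nmul0l.
Qed.

Lemma ghost_vert v e : E' e ** V v = if src e == v then E' e else 0.
Proof.
rewrite -ghost_src -nmulA vertM; case: eqP => // _; exact: nmul0r.
Qed.

Lemma vert_sum v (r : seq (arrow G)) : uniq r -> r != [::] ->
  (forall e, (e \in r) = (src e == v)) -> V v = \sum_(e <- r) E e ** E' e.
Proof.
move=> ur r0 rv; have /congr_rel/pclassP := lpa_CK2 F ur r0 rv; rewrite /lpa_vert => ->.
elim: r {ur r0 rv} => [|e r IH]; first by rewrite big_nil.
by rewrite big_cons -IH /= pclass_add pclass_mul.
Qed.

Lemma arr_ghost_orth e f :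
  (E e ** E' e) ** (E f ** E' f) = if e == f then E e ** E' e else 0.
Proof.
rewrite nmulA -[E e ** _ ** _]nmulA ghost_arr; case: eqP => [->|_].
  by rewrite arr_tgt.
by rewrite nmul0r nmul0l.
Qed.

(* [pathL v p] and [ghostL v p] are [0] unless [p] is a path starting at [v]. *)
Fixpoint pathL v p : L :=
  if p is e :: p' then (V v ** E e) ** pathL (tgt e) p' else V v.

Fixpoint ghostL v p : L :=
  if p is e :: p' then ghostL (tgt e) p' ** (E' e ** V v) else V v.

Lemma pathL_start v p : V v ** pathL v p = pathL v p.
Proof. by case: p => [|e p] /=; rewrite ?nmulA vert_idem. Qed.

Lemma ghostL_start v p : ghostL v p ** V v = ghostL v p.
Proof. by case: p => [|e p] /=; rewrite -?nmulA vert_idem. Qed.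

Lemma pathL_end v p : pathL v p ** V (pend v p) = pathL v p.
Proof. by elim: p v => [|e p IH] v /=; rewrite ?vert_idem // -nmulA IH. Qed.

Lemma ghostL_end v p : V (pend v p) ** ghostL v p = ghostL v p.
Proof. by elim: p v => [|e p IH] v /=; rewrite ?vert_idem // nmulA IH. Qed.

Lemma pathL_cat v p q : pathL v (p ++ q) = pathL v p ** pathL (pend v p) q.
Proof.
elim: p v => [|e p IH] v /=; first by rewrite pathL_start.
by rewrite IH nmulA.
Qed.

Lemma ghostL_cat v p q : ghostL v (p ++ q) = ghostL (pend v p) q ** ghostL v p.
Proof.
elim: p v => [|e p IH] v /=; first by rewrite ghostL_start.
by rewrite IH -nmulA.
Qed.

Lemma pathL1 v e : pathL v [:: e] = V v ** E e.
Proof. by rewrite /= -nmulA arr_tgt. Qed.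

Lemma ghostL1 v e : ghostL v [:: e] = E' e ** V v.
Proof. by rewrite /= nmulA tgt_ghost. Qed.

Lemma pathL_invalid v p : ~~ is_path v p -> pathL v p = 0.
Proof.
elim: p v => //= e p IH v; rewrite negb_and => /orP[ev|/IH->]; last exact: nmul0r.
by rewrite vert_arr eq_sym (negPf ev) nmul0l.
Qed.

Lemma ghostL_invalid v p : ~~ is_path v p -> ghostL v p = 0.
Proof.
elim: p v => //= e p IH v; rewrite negb_and => /orP[ev|/IH->]; last exact: nmul0l.
by rewrite ghost_vert (negPf ev) nmul0r.
Qed.

Lemma pathL_vert v p w : pathL v p ** V w = if pend v p == w then pathL v p else 0.
Proof.
rewrite -pathL_end -nmulA vertM; case: eqP => // _; exact: nmul0r.
Qed.

Lemma vert_pathL v p w : V w ** pathL v p = if w == v then pathL v p else 0.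
Proof.
rewrite -pathL_start nmulA vertM; case: eqP => [->//|_]; exact: nmul0l.
Qed.

Lemma ghostL_vert v p w : ghostL v p ** V w = if v == w then ghostL v p else 0.
Proof.
rewrite -ghostL_start -nmulA vertM; case: eqP => // _; exact: nmul0r.
Qed.

Lemma ghost_pathL_cons g v e p : E' g ** pathL v (e :: p) =
  if (g == e) && (v == src e) then pathL (tgt e) p else 0.
Proof.
rewrite /= vert_arr; case: (v == src e); last by rewrite andbF nmul0l nmul0r.
rewrite nmulA ghost_arr andbT; case: eqP => [->|_]; last exact: nmul0l.
exact: pathL_start.
Qed.

Lemma ghostL_cons_arr v e p g : ghostL v (e :: p) ** E g =
  if (e == g) && (v == src g) then ghostL (tgt g) p else 0.
Proof.
rewrite /= -!nmulA vert_arr; case: (v == src g); last by rewrite andbF !nmul0r.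
rewrite ghost_arr andbT; case: eqP => [->|_]; last by rewrite !nmul0r.
exact: ghostL_start.
Qed.

Lemma ghost_pathL v p : is_path v p -> ghostL v p ** pathL v p = V (pend v p).
Proof.
elim: p v => [|e p IH] v /=; first by rewrite vert_idem.
move=> /andP[/eqP ev pp].
rewrite -!nmulA [V v ** (V v ** _)]nmulA vert_idem [V v ** (_ ** _)]nmulA.
rewrite -ev src_arr [E' e ** _]nmulA ghost_arr eqxx pathL_start.
exact: IH.
Qed.

Lemma pathL_neq0 v p : is_path v p -> pathL v p != 0.
Proof.
move=> pp; apply: contra_neq (lpa_vert_neq0 F (pend v p)) => p0.
by rewrite -(ghost_pathL pp) p0 nmul0r.
Qed.

Lemma ghost_path_cancel v p q : is_path v p ->
  ghostL v p ** pathL v (p ++ q) = pathL (pend v p) q.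
Proof. by move=> pp; rewrite pathL_cat nmulA ghost_pathL // pathL_start. Qed.

Lemma ghost_path_cancelr v p q : is_path v p ->
  ghostL v (p ++ q) ** pathL v p = ghostL (pend v p) q.
Proof. by move=> pp; rewrite ghostL_cat -nmulA ghost_pathL // ghostL_start. Qed.

Lemma ghostL_pathL_compare v p q :
  [\/ ghostL v p ** pathL v q = 0, exists r, q = p ++ r | exists r, p = q ++ r].
Proof.
elim: p v q => [|e p IH] v q /=; first by constructor 2; exists q.
case: q => [|f q]; first by constructor 3; exists (e :: p).
have [<-|ef] := eqVneq e f; last first.
  constructor 1; rewrite -/(pathL v (f :: q)) -!nmulA pathL_start.
  by rewrite ghost_pathL_cons (negPf ef) nmul0r.
case: (IH (tgt e) q) => [pq|[r ->]|[r ->]].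
- constructor 1; rewrite -/(pathL v (e :: q)) -!nmulA pathL_start.
  rewrite ghost_pathL_cons eqxx /=.
  by case: eqP => // _; rewrite nmul0r.
- by constructor 2; exists r.
- by constructor 3; exists r.
Qed.

(** Along [p] each vertex emits a single arrow [e], for which CK2 reads [ee^* = src e]. *)
Lemma pathL_ghostL v p : unbranched v -> is_path v p -> pathL v p ** ghostL v p = V v.
Proof.
elim: p v => [|e p IH] v vU /=; first by rewrite vert_idem.
move=> /andP[/eqP ev pp].
have /(unbranched_pend vU) : is_path v [:: e] by rewrite /= ev eqxx.
rewrite nmulA -[_ ** pathL _ _ ** ghostL _ _]nmulA => /IH -> //.
rewrite -[V v ** E e ** _]nmulA arr_tgt -ev src_arr ghost_src.
have := @vert_sum (src e) [:: e] _ _ _; rewrite big_seq1 => -> // f.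
rewrite inE; apply/eqP/eqP => [->//|fe].
by apply: (vU [::]); rewrite ?ev // fe.
Qed.

Lemma cycle_pathL_ghostL v p : on_cycle v -> is_path v p ->
  pathL v p ** ghostL v p = V v.
Proof. by move=> /on_cycle_unbranched; exact: pathL_ghostL. Qed.

End PathElements.

Section Reduction.
Variables (F : fieldType) (G : digraph).
Local Notation L := (LPA F G).
Implicit Types (v w : vertex G) (e f : arrow G) (p q : seq (arrow G)) (x y z : L).

Local Notation V := (lpa_vert F).
Local Notation E := (lpa_arr F).
Local Notation E' := (lpa_ghost F).
Local Notation pathL := (pathL F).
Local Notation ghostL := (ghostL F).

Lemma pathL_arr v p f : pathL v p ** E f = pathL v (rcons p f).
Proof. by rewrite -cats1 pathL_cat pathL1 nmulA pathL_end. Qed.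

Lemma ghostL_ghost w q e :
  ghostL w q ** E' e = if w == tgt e then ghostL (src e) (e :: q) else 0.
Proof.
rewrite -tgt_ghost nmulA ghostL_vert; case: eqP => [->|_]; last exact: nmul0l.
by rewrite /= ghost_src.
Qed.

(** Only the ghost length is bounded, since it is what right multiplication by arrows decreases.
    Incompatible data are harmless: they give 0. *)
Definition monomial (n : nat) x : Prop :=
  exists k v p w q, (size q <= n)%N /\ x = k *: (pathL v p ** ghostL w q).

Lemma monomial_le m n x : (m <= n)%N -> monomial m x -> monomial n x.
Proof.
move=> mn [k [v [p [w [q [qm ->]]]]]]; exists k, v, p, w, q; split=> //.
exact: leq_trans mn.
Qed.

Lemma sum_of_monomial_gen n k v p w q : (size q <= n)%N ->
  sum_of (monomial n) (k *: (pathL v p ** ghostL w q)).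
Proof. by move=> qn; apply: sum_of1; exists k, v, p, w, q. Qed.

Lemma sum_of_monomial_vert n x u :
  sum_of (monomial n) x -> sum_of (monomial n) (x ** V u).
Proof.
apply: sum_of_mulr => _ [k [v [p [w [q [qn ->]]]]]].
rewrite -nscaleAl -nmulA ghostL_vert; case: eqP => _.
  exact: sum_of_monomial_gen.
by rewrite nmul0r scaler0; exact: sum_of0.
Qed.

Lemma sum_of_monomial_ghost n x e :
  sum_of (monomial n) x -> sum_of (monomial n.+1) (x ** E' e).
Proof.
apply: sum_of_mulr => _ [k [v [p [w [q [qn ->]]]]]].
rewrite -nscaleAl -nmulA ghostL_ghost; case: eqP => _.
  exact: sum_of_monomial_gen.
by rewrite nmul0r scaler0; exact: sum_of0.
Qed.

Lemma monomial_arr n x e :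
  monomial n x -> sum_of (monomial n.-1) (x ** E e).
Proof.
move=> [k [v [p [w [q [qn ->]]]]]]; rewrite -nscaleAl -nmulA.
case: q qn => [|f q] qn.
  rewrite vert_arr; case: eqP => _; last by rewrite nmul0r scaler0; exact: sum_of0.
  (* With no ghost arrow left, the arrow extends the path part, whose end vertex then serves as an
     empty ghost part. *)
  rewrite pathL_arr -pathL_end; exact: (@sum_of_monomial_gen _ _ _ _ _ [::]).
rewrite ghostL_cons_arr; case: ifP => _; last by rewrite nmul0r scaler0; exact: sum_of0.
by apply: sum_of_monomial_gen; case: n qn.
Qed.

Lemma sum_of_monomial_arr n x e :
  sum_of (monomial n) x -> sum_of (monomial n.-1) (x ** E e).
Proof. by apply: sum_of_mulr => m; exact: monomial_arr. Qed.

Lemma sum_of_monomial_le m n x : (m <= n)%N ->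
  sum_of (monomial m) x -> sum_of (monomial n) x.
Proof.
by move=> mn; apply: sum_of_sub => z /(monomial_le mn); exact: sum_of1.
Qed.

Definition spanned x : Prop := exists n, sum_of (monomial n) x.

Lemma spannedD x y : spanned x -> spanned y -> spanned (x + y).
Proof.
move=> [m xm] [n yn]; exists (maxn m n); apply: sum_ofD.
  by apply: sum_of_monomial_le xm; exact: leq_maxl.
by apply: sum_of_monomial_le yn; exact: leq_maxr.
Qed.

Lemma spannedZ k x : spanned x -> spanned (k *: x).
Proof.
move=> [n xn]; exists n; apply: (sum_of_morph (f := fun x => k *: x)) xn.
- exact: scaler0.
- exact: scalerDr.
move=> _ [l [v [p [w [q [qn ->]]]]]]; rewrite scalerA.
exact: sum_of_monomial_gen.
Qed.

Lemma spannedM x (t : expr F (lpa_gen G)) :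
  spanned x -> spanned (x ** (pclass _ t : L)).
Proof.
elim: t x => [[v|e|e]||s IHs t IHt|k s IH|s IHs t IHt] x [n xn].
- by exists n; exact: sum_of_monomial_vert.
- by exists n.-1; exact: sum_of_monomial_arr.
- by exists n.+1; exact: sum_of_monomial_ghost.
- by rewrite pclass0 nmul0r; exists 0%N; exact: sum_of0.
- by rewrite pclass_add nmulDr; apply: spannedD; [apply: IHs | apply: IHt]; exists n.
- by rewrite pclass_scale -nscaleAr; apply: spannedZ; apply: IH; exists n.
- by rewrite pclass_mul nmulA; apply: IHt; apply: IHs; exists n.
Qed.

(** The generators are monomials, and the span is stable under right multiplication by generators;
    stability under all expressions follows by structural induction. *)
Lemma lpa_spanned x : spanned x.
Proof.
elim/pclass_ind: x; elim=> [[v|e|e]||s IHs t IHt|k s IH|s IHs t IHt].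
- exists 0%N; apply: sum_of1; exists 1, v, [::], v, [::]; split=> //.
  by rewrite /= scale1r vert_idem.
- exists 0%N; apply: sum_of1; exists 1, (src e), [:: e], (tgt e), [::]; split=> //.
  by rewrite scale1r pathL1 src_arr /= arr_tgt.
- exists 1%N; apply: sum_of1; exists 1, (tgt e), [::], (src e), [:: e]; split=> //.
  by rewrite scale1r ghostL1 ghost_src /= tgt_ghost.
- by exists 0%N; exact: sum_of0.
- by rewrite pclass_add; exact: spannedD.
- by rewrite pclass_scale; exact: spannedZ.
- by rewrite pclass_mul; exact: spannedM.
Qed.

Lemma vert_left_neq0 x : x != 0 -> exists v, V v ** x != 0.
Proof.
apply: (orth_nonzero (T := fun v x => V v ** x)).
- by move=> v; exact: nmul0r.
- by move=> v y z; exact: nmulDr.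
- move=> u v y; rewrite nmulA vertM eq_sym; case: eqP => [->//|_]; exact: nmul0l.
have [n] := lpa_spanned x; apply: sum_of_sub => _ [k [v [p [w [q [_ ->]]]]]].
by apply: sum_of1; exists v; rewrite -nscaleAr nmulA pathL_start.
Qed.

Lemma vert_right x : exists2 s : seq (vertex G), uniq s & x = \sum_(v <- s) x ** V v.
Proof.
apply: (orth_decomp (T := fun v x => x ** V v)).
- by move=> v; exact: nmul0l.
- by move=> v y z; exact: nmulDl.
- move=> u v y; rewrite -nmulA vertM; case: eqP => [->//|_]; exact: nmul0r.
have [n] := lpa_spanned x; apply: sum_of_sub => _ [k [v [p [w [q [_ ->]]]]]].
by apply: sum_of1; exists w; rewrite -nscaleAl -nmulA ghostL_start.
Qed.

Lemma vert_right_neq0 x : x != 0 -> exists v, x ** V v != 0.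
Proof.
apply: contra_neqP => nx; have [s _ ->] := vert_right x.
by rewrite big1 // => v _; apply/eqP/negP => /negP xv; apply: nx; exists v.
Qed.

(** The vertex [w] on both sides annihilates every path that is not closed at [w], so lists need no
    validity condition. *)
Definition closed_sum w (l : seq (F * seq (arrow G))) : L :=
  \sum_(c <- l) c.1 *: (pathL w c.2 ** V w).

Definition nonempty_paths (l : seq (F * seq (arrow G))) : Prop :=
  all (fun c => c.2 != [::]) l.

Lemma lact_pathL_degree v p (h : wfun F G) n0 :
  (forall b n, n != n0 -> h b n = 0) ->
  forall b n, n != n0 + (size p)%:Z -> lact (pathL v p) h b n = 0.
Proof.
elim: p v h n0 => [|e p IH] v h n0 h0 b n /=.
  rewrite addr0 => nn; rewrite lact_class /=; case: ifP => // _; exact: h0.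
move=> nn; rewrite !lactM; apply: (IH _ _ (n0 + 1)); last first.
  by rewrite -addrA -PoszD add1n.
move=> b' m mn; rewrite !lact_class /=; case: ifP => // _; case: ifP => // _.
by apply: h0; rewrite subr_eq.
Qed.

(** Nonempty paths strictly raise the degree. Applied to a point mass in degree 0 and evaluated at
    the same point, the element therefore returns [k]. *)
Lemma leading_neq0 w k l : k != 0 -> nonempty_paths l ->
  k *: V w + closed_sum w l != 0.
Proof.
move=> k0 l0; apply: contra_neq k0 => y0.
have := lact0 (point_mass F (greedy_walk w) 0) (greedy_walk w) 0.
rewrite -y0 lactD lactZ lact_vert_mass /point_mass asboolT // eqxx /= mulr1.
rewrite lact_sum big_seq big1 ?addr0 // => c cl.
rewrite lactZ lactM lact_class /=; case: ifP => _; last by rewrite mulr0.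
rewrite (@lact_pathL_degree _ _ _ 0) ?mulr0 //.
  by move=> b n n0; rewrite (negPf n0) andbF.
by rewrite add0r eq_sym eqz_nat size_eq0; move/allP: l0 => /(_ c cl).
Qed.

(** Terms that are killed disappear from the list, so its length can serve as the induction
    measure. *)
Definition conj_paths (g : arrow G) (l : seq (F * seq (arrow G))) :=
  pmap (fun c => if c.2 is h :: c' then
                   if g == h then Some (c.1, rcons c' g) else None
                 else None) l.

Lemma size_conj_paths g l : (size (conj_paths g l) <= size l)%N.
Proof. by rewrite size_pmap count_size. Qed.

Lemma conj_paths_nonempty g l : nonempty_paths (conj_paths g l).
Proof.
apply/allP => c; rewrite mem_pmap => /mapP[[a [//|h c']] _] /=.
by case: ifP => // _ [->]; case: c'.
Qed.

Lemma conj_arrow k g l : nonempty_paths l ->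
  E' g ** (k *: V (src g) + closed_sum (src g) l) ** E g =
  k *: V (tgt g) + closed_sum (tgt g) (conj_paths g l).
Proof.
move=> l0; rewrite nmulDr nmulDl -nscaleAr -nscaleAl ghost_src ghost_arr eqxx.
congr (_ + _); rewrite /closed_sum nmul_sumr nmul_suml.
elim: l l0 => [|[a [//|h c]] l IH] /=; first by rewrite !big_nil.
move=> l0; rewrite big_cons IH //= -nscaleAr -nscaleAl.
have -> : E' g ** (pathL (src g) (h :: c) ** V (src g)) ** E g =
    if g == h then pathL (tgt g) (rcons c g) ** V (tgt g) else 0.
  rewrite nmulA ghost_pathL_cons -nmulA src_arr; case: eqP => [<-|_] /=; last exact: nmul0l.
  by rewrite eqxx pathL_arr pathL_vert pend_rcons eqxx.
by case: eqP => [_|_]; rewrite ?big_cons // scaler0 add0r.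
Qed.

Lemma conj_path_cons k g p l :
  ghostL (src g) (g :: p) ** (k *: V (src g) + closed_sum (src g) l)
    ** pathL (src g) (g :: p) =
  ghostL (tgt g) p ** (E' g ** (k *: V (src g) + closed_sum (src g) l) ** E g)
    ** pathL (tgt g) p.
Proof. by rewrite /= src_arr ghost_src !nmulA. Qed.

Lemma conj_step k g w l : src g = w -> nonempty_paths l ->
  (exists p l', [/\ is_path (tgt g) p, nonempty_paths l',
    ghostL (tgt g) p ** (k *: V (tgt g) + closed_sum (tgt g) (conj_paths g l))
      ** pathL (tgt g) p = k *: V (pend (tgt g) p) + closed_sum (pend (tgt g) p) l' &
    l' = [::] \/ on_cycle (pend (tgt g) p)]) ->
  exists p l', [/\ is_path w p, nonempty_paths l',
    ghostL w p ** (k *: V w + closed_sum w l) ** pathL w p =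
      k *: V (pend w p) + closed_sum (pend w p) l' &
    l' = [::] \/ on_cycle (pend w p)].
Proof.
move=> <- n1 [p [l' [pp n' eq' l'P]]]; exists (g :: p), l'; split=> //=.
  by rewrite eqxx.
by rewrite conj_path_cons conj_arrow.
Qed.

(* Conjugating by an arrow rotates the closed paths starting with it and kills
   the others.  At a vertex emitting two arrows one of the terms is killed, and
   moving along a closed path ends at such a vertex unless it is a cycle without
   exit. *)
Lemma conj_reduce k l w : nonempty_paths l ->
  exists p l', [/\ is_path w p, nonempty_paths l',
    ghostL w p ** (k *: V w + closed_sum w l) ** pathL w p =
      k *: V (pend w p) + closed_sum (pend w p) l' &
    l' = [::] \/ on_cycle (pend w p)].
Proof.
have [n] := ubnP (size l); elim: n l w => // n IH l w /ltnSE sl l0.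
(* Follow the first closed path along [c1] to the source of [e], rotating it at each arrow, then
   step off along [f]. This kills the head term and leaves fewer than [n] terms for the outer
   induction. *)
have bif c1 a e c2 f v l' : (size l' < n)%N -> nonempty_paths l' ->
    is_path v (rcons c1 e) -> src f = src e -> f != e ->
    exists p l1, [/\ is_path v p, nonempty_paths l1,
      ghostL v p ** (k *: V v + closed_sum v ((a, c1 ++ e :: c2) :: l')) ** pathL v p =
        k *: V (pend v p) + closed_sum (pend v p) l1 &
      l1 = [::] \/ on_cycle (pend v p)].
  elim: c1 v c2 l' => [|g c1 IHc] v c2 l' sl' l'0.
    rewrite /= andbT => /eqP <- fe ef; rewrite -fe; apply: conj_step => //=.
    rewrite (negPf ef); apply: IH (conj_paths_nonempty _ _).
    exact: leq_ltn_trans (size_conj_paths _ _) sl'.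
  rewrite rcons_cons /= => /andP[/eqP <- pc1] fe ef; apply: conj_step => //=.
  rewrite eqxx rcons_cat rcons_cons; apply: IHc => //.
    exact: leq_ltn_trans (size_conj_paths _ _) sl'.
  exact: conj_paths_nonempty.
case: l l0 sl => [|[a c] l] l0 sl.
  exists [::], [::]; split=> //; last by left.
  rewrite /= nmulDr nmulDl -nscaleAr -nscaleAl !vert_idem /closed_sum !big_nil.
  by rewrite nmul0r nmul0l.
move: (l0) => /andP[/= c0 l'0].
have [/andP[pc /eqP ce]|nc] := boolP (is_path w c && (pend w c == w)); last first.
  have [p [l1 P]] := IH l w sl l'0; exists p, l1.
  suff -> : closed_sum w ((a, c) :: l) = closed_sum w l by [].
  rewrite /closed_sum big_cons /= pathL_vert.
  case: eqP nc => [_|_ _]; last by rewrite scaler0 add0r.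
  by rewrite andbT => /(pathL_invalid F) ->; rewrite scaler0 add0r.
have [ne|nne] := pselect (no_exit c).
  have wC := closed_path_on_cycle c0 pc ce ne.
  exists [::], ((a, c) :: l); split=> //; last by right.
  rewrite /= nmulDr nmulDl -nscaleAr -nscaleAl !vert_idem /closed_sum.
  congr (_ + _); rewrite nmul_sumr nmul_suml; apply: eq_bigr => m _.
  by rewrite -nscaleAr -nscaleAl !nmulA pathL_start -nmulA vert_idem.
have [e [f [ec fe ef]]] : exists e f, [/\ e \in c, src f = src e & f != e].
  apply: contrapT => nef; apply: nne => e f ec fe; apply/eqP/negP => /negP ef.
  by apply: nef; exists e, f.
move: pc {ce c0 l0}; have /splitPr[c1 c2] := ec => pc.
apply: (bif c1 a e c2 f w l) => //.
by move: pc; rewrite -cat_rcons is_path_cat => /andP[].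
Qed.

(** The strict bound makes [n = 0] allow no monomial at all, which is the vacuous base case of
    [leading_path]. *)
Definition path_monomial (n : nat) x : Prop :=
  exists k v p, (size p < n)%N /\ x = k *: pathL v p.

Lemma path_monomial_expand n v x : sum_of (path_monomial n) x ->
  exists K l, [/\ nonempty_paths l, all (fun c => size c.2 < n)%N l &
    V v ** x = K *: V v + \sum_(c <- l) c.1 *: pathL v c.2].
Proof.
apply: (sum_of_ind (T := fun x => exists K l,
  [/\ nonempty_paths l, all (fun c => size c.2 < n)%N l &
    V v ** x = K *: V v + \sum_(c <- l) c.1 *: pathL v c.2])).
  by exists 0, [::]; split; rewrite // big_nil scale0r nmul0r addr0.
move=> _ y [k [u [p [pn ->]]]] [K [l [l0 ln yE]]].
rewrite nmulDr -nscaleAr vert_pathL yE; case: eqP => [<-|_]; last first.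
  by exists K, l; rewrite scaler0 add0r.
case: p pn => [|e p] pn.
  by exists (k + K), l; rewrite /= scalerDl addrA.
exists K, ((k, e :: p) :: l); split; rewrite /nonempty_paths /= ?ln ?andbT //.
by rewrite big_cons addrCA.
Qed.

Lemma path_monomial_shorten n v p w e : (size p < n.+1)%N -> p != [::] ->
  sum_of (path_monomial n) (E' e ** (pathL v p ** V w)).
Proof.
case: p => // f p pn _; rewrite nmulA ghost_pathL_cons.
case: ifP => _; last by rewrite nmul0l; exact: sum_of0.
rewrite pathL_vert; case: eqP => _; last exact: sum_of0.
by apply: sum_of1; exists 1, (tgt f), p; rewrite scale1r.
Qed.

(** Either [v = w] and the trivial path has a nonzero coefficient, or every term begins with an
    arrow. In the latter case each term is fixed by some [ee^*], so some [e^* x] is nonzero, and its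
    paths are one arrow shorter. *)
Lemma leading_path n v w x : sum_of (path_monomial n) x ->
  V v ** x = x -> x ** V w = x -> x != 0 ->
  exists p k l, [/\ is_path v p, pend v p = w, k != 0, nonempty_paths l &
    ghostL v p ** x = k *: V w + closed_sum w l].
Proof.
elim: n v x => [|n IH] v x xP xv xw x0.
  move: x0; rewrite (_ : x = 0) ?eqxx //.
  by apply: (sum_of_ind (T := fun x => x = 0)) xP => // m y [? [? [p []]]]; rewrite ltn0.
have [K [l [l0 ln vx]]] := path_monomial_expand v xP.
have {vx} xE : x = K *: (V v ** V w) + \sum_(c <- l) c.1 *: (pathL v c.2 ** V w).
  rewrite -{1}xw -{1}xv vx nmulDl -nscaleAl; congr (_ + _).
  by rewrite nmul_suml; apply: eq_bigr => c _; rewrite -nscaleAl.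
have [/andP[/eqP vw K0]|Kvw] := boolP ((v == w) && (K != 0)).
  subst w; exists [::], K, l; split=> //.
  by rewrite /= xv xE vert_idem.
have {}xE : x = \sum_(c <- l) c.1 *: (pathL v c.2 ** V w).
  rewrite {1}xE vertM; move: Kvw; rewrite negb_and negbK.
  by case: (v == w) => /= [/eqP->|_]; rewrite ?scale0r ?scaler0 add0r.
have [e ex] : exists e, E e ** (E' e ** x) != 0.
  move: x0; apply: (orth_nonzero (T := fun e x => E e ** (E' e ** x))).
  - by move=> e; rewrite !nmul0r.
  - by move=> e y z; rewrite !nmulDr.
  - move=> e f y; rewrite !nmulA -[_ ** E e ** _]nmulA arr_ghost_orth [f == e]eq_sym.
    by case: eqP => [->|_]; rewrite ?nmul0l.
  exists [seq c.1 *: (pathL v c.2 ** V w) | c <- l]; last by rewrite big_map.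
  move=> _ /mapP[[a [|e p]] cl ->]; first by move/allP: l0 => /(_ _ cl).
  exists e => /=; rewrite -!nscaleAr [E' e ** _]nmulA ghost_pathL_cons eqxx /=.
  by rewrite nmulA vert_arr; case: eqP => _; rewrite ?(nmul0l, nmul0r).
have ex0 : E' e ** x != 0 by apply: contra_neq ex => ->; exact: nmul0r.
have ev : src e = v.
  by apply: contra_neq_eq ex0 => ev; rewrite -xv nmulA ghost_vert (negPf ev) nmul0l.
case: (IH (tgt e) (E' e ** x)) => //.
- rewrite xE nmul_sumr big_seq; apply: big_ind => [||[a p] /= pl].
  + exact: sum_of0.
  + exact: sum_ofD.
  rewrite -nscaleAr.
  apply: (@sum_of_morph _ (path_monomial n) (path_monomial n) (fun y => a *: y)).
  + exact: scaler0.
  + exact: scalerDr.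
  + move=> _ [k [u [q [qn ->]]]]; apply: sum_of1.
    by exists (a * k), u, q; rewrite scalerA.
  apply: path_monomial_shorten; first by move/allP: ln => /(_ _ pl).
  by move/allP: l0 => /(_ _ pl).
- by rewrite nmulA tgt_ghost.
- by rewrite -nmulA xw.
move=> p [k [l' [pp pw k0 l'0 eq']]]; exists (e :: p), k, l'; split=> //=.
- by rewrite ev eqxx.
- by rewrite -eq' -!nmulA xv.
Qed.

(** A nonempty ghost part ends in some [e^*], and [e^* e e^* = e^*]; hence such a monomial is fixed
    by [ee^*] on the right. *)
Lemma monomial_path_or_ghost n x :
  sum_of (monomial n) x -> exists r y, [/\ x = r + y,
    (exists m, sum_of (path_monomial m) r) &
    sum_of (fun m => exists e, m ** (E e ** E' e) = m) y].
Proof.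
apply: (sum_of_ind (T := fun x => exists r y, [/\ x = r + y,
    (exists m, sum_of (path_monomial m) r) &
    sum_of (fun m => exists e, m ** (E e ** E' e) = m) y])).
  by exists 0, 0; rewrite addr0; split; [|exists 0%N|]; try exact: sum_of0.
move=> _ _ [k [v [p [w [q [_ ->]]]]]] [r [y [-> [m rm] yP]]].
case: q => [|e q].
  exists (k *: (pathL v p ** V w) + r), y; rewrite addrA; split=> //.
  exists (maxn m (size p).+1); apply: sum_ofD.
    rewrite pathL_vert; case: eqP => _; last by rewrite scaler0; exact: sum_of0.
    by apply: sum_of1; exists k, v, p; split=> //; exact: leq_maxr.
  apply: sum_of_sub rm => z [l [u [c [cm zE]]]]; apply: sum_of1.
  by exists l, u, c; split=> //; apply: leq_trans cm _; exact: leq_maxl.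
exists r, (k *: (pathL v p ** ghostL w (e :: q)) + y); rewrite addrCA; split=> //.
  by exists m.
apply: sum_ofD yP; apply: sum_of1; exists e.
rewrite -nscaleAl -nmulA; congr (_ *: (_ ** _)).
rewrite nmulA ghostL_cons_arr eqxx /= ghost_vert.
by case: eqP => [->|we]; rewrite ?eqxx // nmul0l; case: eqP => [/esym//|]; rewrite nmul0r.
Qed.

Lemma arr_ghost_vert e w : E e ** E' e ** V w = V w ** (E e ** E' e).
Proof.
rewrite nmulA vert_arr -nmulA ghost_vert eq_sym; case: eqP => // _.
by rewrite nmul0l nmul0r.
Qed.

(* At a vertex emitting infinitely many arrows, some arrow [f] is not met by the
   ghost part of [x], so that [x f = 0] would force the path part to vanish. *)
Lemma killed_by_arrows x w : x != 0 -> x ** V w = x -> (forall e, x ** E e = 0) ->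
  exists m, sum_of (path_monomial m) x.
Proof.
move=> x0 xw xE; have [n /monomial_path_or_ghost[r [y [xry [m rm] yP]]]] := lpa_spanned x.
have [s us yE] : exists2 s : seq (arrow G), uniq s & y = \sum_(e <- s) y ** (E e ** E' e).
  apply: (orth_decomp (T := fun e x => x ** (E e ** E' e))) yP.
  - by move=> e; rewrite nmul0l.
  - by move=> e u v; rewrite nmulDl.
  - move=> e f z; rewrite -nmulA arr_ghost_orth.
    by case: eqP => [_|_]; rewrite ?nmul0r.
(* As [x] kills arrows, the path part alone determines the ghost part, term by term over [s]. *)
have ye e : y ** (E e ** E' e) = - (r ** (E e ** E' e)).
  by rewrite -[y](addKr r) -xry nmulDl !nmulA xE nmul0l addr0 nmulNl nmulNl.
have {}xE' : x = r - \sum_(e <- s) r ** (E e ** E' e).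
  by rewrite {1}xry {1}yE -sumrN; congr (_ + _); apply: eq_bigr.
(* If [s] contains every arrow from [w], there are finitely many. When there is one, CK2 writes [x]
   as a sum of terms [x g g^*], all zero; when [w] is a sink, the ghost terms vanish and only paths
   remain. *)
have [[f fs fw]|nf] := pselect (exists2 f, f \notin s & src f = w); last first.
  case: (pselect (exists e, src e = w)) => [[e ew]|ne].
    case/eqP: x0; rewrite -xw.
    have uE : uniq [seq e <- s | src e == w] by exact: filter_uniq.
    rewrite (vert_sum F uE).
    + by rewrite nmul_sumr big1 // => g _; rewrite nmulA xE nmul0l.
    + have : e \in [seq e <- s | src e == w].
        rewrite mem_filter ew eqxx; apply/negPn/negP => es.
        by apply: nf; exists e.
      by case: filter.
    move=> g; rewrite mem_filter andb_idr // => /eqP gw.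
    by apply/negPn/negP => gs; apply: nf; exists g.
  exists m; rewrite -xw xE' nmulBl nmul_suml big1 => [|e _]; last first.
    rewrite -!nmulA ghost_vert; case: eqP => [ew|_]; last by rewrite !nmul0r.
    by case: ne; exists e.
  rewrite subr0; apply: sum_of_mulr rm => _ [k [v [p [pm ->]]]].
  rewrite -nscaleAl pathL_vert; case: eqP => _; last by rewrite scaler0; exact: sum_of0.
  by apply: sum_of1; exists k, v, p.
have rw0 : r ** V w != 0.
  apply: contra_neq x0 => rw0; rewrite -xw xE' nmulBl rw0 nmul_suml big1 ?subr0 // => e _.
  by rewrite -nmulA arr_ghost_vert nmulA rw0 nmul0l.
have rf0 : r ** E f = 0.
  rewrite -(xE f) {1}xE' nmulBl nmul_suml big_seq big1 ?subr0 // => e es.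
  rewrite -!nmulA ghost_arr; case: eqP => [ef|_]; last by rewrite !nmul0r.
  by rewrite -ef es in fs.
have [v vr0] := vert_left_neq0 rw0.
have rvP : sum_of (path_monomial m) (V v ** (r ** V w)).
  have: sum_of (path_monomial m) (r ** V w).
    apply: sum_of_mulr rm => _ [k [u [p [pm ->]]]].
    rewrite -nscaleAl pathL_vert; case: eqP => _; last by rewrite scaler0; exact: sum_of0.
    by apply: sum_of1; exists k, u, p.
  apply: sum_of_mull => _ [k [u [p [pm ->]]]].
  rewrite -nscaleAr vert_pathL; case: eqP => _; last by rewrite scaler0; exact: sum_of0.
  by apply: sum_of1; exists k, u, p.
have vvr : V v ** (V v ** (r ** V w)) = V v ** (r ** V w) by rewrite nmulA vert_idem.
have vrw : V v ** (r ** V w) ** V w = V v ** (r ** V w) by rewrite -!nmulA vert_idem.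
have [p [k [l [pp pw k0 l0 lE]]]] := leading_path rvP vvr vrw vr0.
(* Conjugating the leading form of [r w] by [f] keeps the coefficient [k], so the result is nonzero,
   although [r f = 0]. *)
have := leading_neq0 (tgt f) k0 (conj_paths_nonempty f l).
by rewrite -conj_arrow // fw -lE -!nmulA -{1}fw src_arr rf0 !nmul0r eqxx.
Qed.

Lemma sum_of_path_monomial0 x :
  sum_of (monomial 0) x -> exists m, sum_of (path_monomial m) x.
Proof.
apply: (@sum_of_ind _ (monomial 0) (fun x => exists m, sum_of (path_monomial m) x)).
  by exists 0%N; exact: sum_of0.
move=> _ y [k [v [p [w [q [+ ->]]]]]] [m ym].
rewrite leqn0 size_eq0 => /eqP-> /=.
exists (maxn m (size p).+1); apply: sum_ofD.
  rewrite pathL_vert; case: eqP => _; last by rewrite scaler0; exact: sum_of0.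
  by apply: sum_of1; exists k, v, p; split=> //; exact: leq_maxr.
apply: sum_of_sub ym => z [l [u [c [cm zE]]]]; apply: sum_of1.
by exists l, u, c; split=> //; apply: leq_trans cm _; exact: leq_maxl.
Qed.

(** Multiply by arrows on the right as long as the product is nonzero, shortening the ghosts each
    time; when all arrows kill the element, [killed_by_arrows] has already removed the ghosts. *)
Lemma kill_ghosts n x : sum_of (monomial n) x -> x != 0 ->
  exists b w m, [/\ sum_of (path_monomial m) (x ** b), x ** b ** V w = x ** b &
    x ** b != 0].
Proof.
elim: n x => [|n IH] x xn /vert_right_neq0[w xw0].
  have [m xm] := sum_of_path_monomial0 (sum_of_monomial_vert w xn).
  by exists (V w), w, m; rewrite -nmulA vert_idem.
have [[e xe0]|xE] := pselect (exists e, x ** V w ** E e != 0).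
  have [b [u [m]]] := IH _ (sum_of_monomial_arr e (sum_of_monomial_vert w xn)) xe0.
  by rewrite -!nmulA => P; exists (V w ** (E e ** b)), u, m; rewrite -!nmulA.
have xww : x ** V w ** V w = x ** V w by rewrite -nmulA vert_idem.
have xwE e : x ** V w ** E e = 0 by apply/eqP/negPn/negP => xe; apply: xE; exists e.
have [m xm] := killed_by_arrows xw0 xww xwE.
by exists (V w), w, m; rewrite -nmulA vert_idem.
Qed.

Lemma reduction v x : V v ** x = x -> x != 0 ->
  exists p, is_path v p /\
   ((exists b, ghostL v p ** x ** b = V (pend v p)) \/
    on_cycle (pend v p) /\ ghostL v p ** x != 0).
Proof.
move=> vx x0; have [n xn] := lpa_spanned x.
have [b [w [m [rm rw r0]]]] := kill_ghosts xn x0.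
have vxb : V v ** (x ** b) = x ** b by rewrite nmulA vx.
have [p [k [l [pp pw k0 l0 lE]]]] := leading_path rm vxb rw r0.
have [q [l' [pq l'0 eq' l'P]]] := conj_reduce k w l0.
exists (p ++ q); rewrite is_path_cat pend_cat pw; split; first by rewrite pp.
have {}eq' : ghostL v (p ++ q) ** x ** (b ** pathL w q) =
    k *: V (pend w q) + closed_sum (pend w q) l'.
  by rewrite -eq' -lE ghostL_cat pw !nmulA.
case: l'P => [l'E|wC]; [left|right].
  exists (k^-1 *: (b ** pathL w q)).
  by rewrite -nscaleAr eq' l'E /closed_sum big_nil addr0 scalerA mulVf ?scale1r.
split=> //; apply: contra_neq (leading_neq0 (pend w q) k0 l'0) => x'0.
by rewrite -eq' x'0 nmul0l.
Qed.

End Reduction.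

(** * The corner ring at a vertex of a cycle without exit *)

Section CycleCorner.
Variables (F : fieldType) (G : digraph) (w : vertex G) (c : seq (arrow G)).
Hypotheses (wc : from_cycle c w) (ne : no_exit c).
Local Notation L := (LPA F G).
Implicit Types (v u : vertex G) (e : arrow G) (p q r : seq (arrow G)) (x y z g : L).
Implicit Types (f h : {poly F}).

Local Notation V := (lpa_vert F).
Local Notation pathL := (pathL F).
Local Notation ghostL := (ghostL F).

Let wC : on_cycle w. Proof. by exists c. Qed.

Definition cpow (i : nat) := flatten (nseq i c).

Lemma cpowD i j : cpow (i + j) = cpow i ++ cpow j.
Proof. by rewrite /cpow nseqD flatten_cat. Qed.

Lemma cpow_closed i : is_path w (cpow i) /\ pend w (cpow i) = w.
Proof.
have [_ [_ [_ _ pc ce _]]] := wc.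
elim: i => //= i [pi ei]; rewrite -[cpow i.+1]/(c ++ cpow i).
by rewrite is_path_cat pend_cat ce pc.
Qed.

Lemma size_cpow i : size (cpow i) = (i * size c)%N.
Proof. by rewrite size_flatten /shape map_nseq sumn_nseq mulnC. Qed.

Definition Cpow i : L := pathL w (cpow i).
Definition Cinv i : L := ghostL w (cpow i).

Lemma Cpow_start i : V w ** Cpow i = Cpow i.
Proof. exact: pathL_start. Qed.

Lemma Cpow_end i : Cpow i ** V w = Cpow i.
Proof. by have [_ wi] := cpow_closed i; have := pathL_end F w (cpow i); rewrite wi. Qed.

Lemma Cinv_start i : V w ** Cinv i = Cinv i.
Proof. by have [_ wi] := cpow_closed i; have := ghostL_end F w (cpow i); rewrite wi. Qed.

Lemma CpowD i j : Cpow (i + j) = Cpow i ** Cpow j.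
Proof. by have [_ wi] := cpow_closed i; rewrite /Cpow cpowD pathL_cat wi. Qed.

Lemma CpowK i : Cpow i ** Cinv i = V w.
Proof. by have [pi _] := cpow_closed i; exact: cycle_pathL_ghostL. Qed.

(** Evaluation of a polynomial at the cycle, with [w] as the unit; it embeds [F[X]] into [wLw]. *)
Definition pev f : L := \sum_(i < size f) f`_i *: Cpow i.

Lemma pevE n f : (size f <= n)%N -> pev f = \sum_(i < n) f`_i *: Cpow i.
Proof.
move=> fn; rewrite /pev (big_ord_widen n (fun i => f`_i *: Cpow i) fn).
rewrite [RHS](bigID (fun i : 'I_n => (i < size f)%N)) /= [X in _ + X]big1 ?addr0 // => i.
by rewrite -leqNgt => fi; rewrite nth_default // scale0r.
Qed.

Lemma pevD f h : pev (f + h) = pev f + pev h.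
Proof.
set n := maxn (size f) (size h).
rewrite (@pevE n (f + h)) ?size_polyD // (@pevE n f) ?leq_maxl //.
rewrite (@pevE n h) ?leq_maxr // -big_split /=.
by apply: eq_bigr => i _; rewrite coefD scalerDl.
Qed.

Lemma pevZ k f : pev (k *: f) = k *: pev f.
Proof.
rewrite (@pevE (size f) (k *: f)) ?size_scale_leq // scaler_sumr.
by apply: eq_bigr => i _; rewrite coefZ scalerA.
Qed.

Lemma pev0 : pev 0 = 0.
Proof. by rewrite -(scale0r 0) pevZ scale0r. Qed.

Lemma pevN f : pev (- f) = - pev f.
Proof. by rewrite -scaleN1r pevZ scaleN1r. Qed.

Lemma pevXn n : pev 'X^n = Cpow n.
Proof.
rewrite /pev size_polyXn big_ord_recr /= coefXn eqxx scale1r big1 ?add0r // => i _.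
by rewrite coefXn ltn_eqF // scale0r.
Qed.

Lemma pev_sum I (s : seq I) (a : I -> {poly F}) :
  pev (\sum_(i <- s) a i) = \sum_(i <- s) pev (a i).
Proof. exact: (big_morph _ pevD pev0). Qed.

Lemma pevM f h : pev (f * h) = pev f ** pev h.
Proof.
rewrite -{1}[f]coefK -{1}[h]coefK !poly_def mulr_suml pev_sum /pev nmul_suml.
apply: eq_bigr => i _; rewrite mulr_sumr -/(pev _) pev_sum nmul_sumr.
apply: eq_bigr => j _; rewrite -scalerAl -scalerAr -exprD !pevZ pevXn CpowD.
by rewrite -nscaleAl -nscaleAr.
Qed.

Lemma pev_start f : V w ** pev f = pev f.
Proof. by rewrite nmul_sumr; apply: eq_bigr => i _; rewrite -nscaleAr Cpow_start. Qed.

Lemma pev_end f : pev f ** V w = pev f.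
Proof. by rewrite nmul_suml; apply: eq_bigr => i _; rewrite -nscaleAl Cpow_end. Qed.

Lemma lact_pathL_mass v p n : on_cycle v -> is_path v p ->
  lact (pathL v p) (point_mass F (greedy_walk v) n) =
  point_mass F (greedy_walk (pend v p)) (n + (size p)%:Z).
Proof.
elim: p v n => [|e p IH] v n vC /=; first by rewrite lact_vert_mass addr0.
move=> /andP[/eqP ev pp]; have fe : first_arrow v = Some e.
  have := first_arrowP v; case: first_arrow => [e' ve|/(_ e) //].
  by congr Some; exact: on_cycle_unique ev ve.
rewrite !lactM lact_vert_mass (lact_arrow_mass _ _ fe) IH //.
  by rewrite -addrA -PoszD add1n.
by apply: on_cycle_tgt; rewrite ev.
Qed.

(** The [i]-th power of the cycle carries the point mass at the infinite cyclic path from degree 0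
    to degree [i * size c]. Evaluation in degree [j * size c] thus reads off the [j]-th
    coefficient. *)
Lemma pev_eq0 f : pev f = 0 -> f = 0.
Proof.
move=> f0; apply/polyP => j; rewrite coef0.
have := lact0 (point_mass F (greedy_walk w) 0) (greedy_walk w) (j * size c)%N.
rewrite -f0 (@pevE (maxn (size f) j.+1)) ?leq_maxl // lact_sum.
have jm : (j < maxn (size f) j.+1)%N by exact: leq_maxr.
rewrite (bigD1 (Ordinal jm)) //= big1 => [|i ij].
  have [pj ej] := cpow_closed j.
  rewrite lactZ lact_pathL_mass // ej size_cpow add0r /point_mass asboolT //.
  by rewrite eqxx mulr1 addr0.
have [pi ei] := cpow_closed i.
rewrite lactZ lact_pathL_mass // ei size_cpow add0r /point_mass asboolT // eqz_nat.
have [e [p [-> _ _ _ _]]] := wc; rewrite eqn_pmul2r //.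
by rewrite eq_sym -val_eqE /= in ij; rewrite (negPf ij) mulr0.
Qed.

Lemma pathL_ghostL_neq v p u q : pend v p != pend u q -> pathL v p ** ghostL u q = 0.
Proof.
move=> /negPf pq; rewrite -pathL_end -ghostL_end nmulA -[_ ** V _ ** V _]nmulA.
by rewrite vertM pq nmul0r nmul0l.
Qed.

(** Clears denominators: the corner consists of Laurent polynomials in the cycle. *)
Lemma corner_poly g : exists n f, V w ** g ** Cpow n = pev f.
Proof.
have [N] := lpa_spanned g.
apply: (sum_of_ind (T := fun g => exists n f, V w ** g ** Cpow n = pev f)).
  by exists 0%N, 0; rewrite nmul0r nmul0l pev0.
move=> _ y [k [v [p [u [q [_ ->]]]]]] [n [f yE]].
suff [j [h mE]] : exists j h,
    V w ** (k *: (pathL v p ** ghostL u q)) ** Cpow j = pev h.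
  (* Addition of two fractions over the common denominator of exponent [j + n]. *)
  exists (j + n)%N, (h * 'X^n + f * 'X^j).
  rewrite pevD !pevM -yE -mE !pevXn -!nmulA -!CpowD (addnC n j).
  by rewrite -nmulDr -nmulDl.
have zero x : V w ** x ** Cpow 0 = 0 -> exists j h, V w ** x ** Cpow j = pev h.
  by exists 0%N, 0; rewrite pev0.
have [pp|np] := boolP (is_path v p); last first.
  by apply: zero; rewrite pathL_invalid // nmul0l scaler0 nmul0r nmul0l.
have [pq|nq] := boolP (is_path u q); last first.
  by apply: zero; rewrite (ghostL_invalid F nq) nmul0r scaler0 nmul0r nmul0l.
have [wv|wv] := eqVneq w v; last first.
  by apply: zero; rewrite -nscaleAr nmulA vert_pathL (negPf wv) nmul0l scaler0 nmul0l.
have [uw|uw] := eqVneq u w; last first.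
  apply: zero; rewrite -Cpow_start nmulA -[_ ** _ ** V w]nmulA -nscaleAl.
  rewrite -[_ ** _ ** V w]nmulA.
  by rewrite ghostL_vert (negPf uw) nmul0r scaler0 nmul0r nmul0l.
subst v u; have [pq_end|pq_end] := eqVneq (pend w p) (pend w q); last first.
  by apply: zero; rewrite pathL_ghostL_neq // scaler0 nmul0r nmul0l.
(* Prolonging [p] and [q] by a common return path makes both closed at [w], hence powers of the
   cycle. Then [p q^*] times [qr] equals [pr]. *)
have [r [rp re]] := on_cycle_return wC pp.
have pr_path : is_path w (p ++ r) by rewrite is_path_cat pp.
have pr_end : pend w (p ++ r) = w by rewrite pend_cat.
have qr_path : is_path w (q ++ r) by rewrite is_path_cat -pq_end pq.
have qr_end : pend w (q ++ r) = w by rewrite pend_cat -pq_end.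
have [i iE] := closed_path_power wc ne pr_path pr_end.
have [j jE] := closed_path_power wc ne qr_path qr_end.
exists j, (k *: 'X^i); rewrite pevZ pevXn -nscaleAr -nscaleAl nmulA pathL_start.
rewrite /Cpow /cpow -jE -iE -nmulA ghost_path_cancel // -pq_end.
by rewrite -pathL_cat.
Qed.

Definition corner_monomial x : Prop := exists k p u q,
  [/\ is_path w p, is_path u q, pend w p = pend u q & x = k *: (pathL w p ** ghostL u q)].

Lemma corner_spanned z : V w ** z = z -> sum_of corner_monomial z.
Proof.
move=> wz; have [n] := lpa_spanned z; rewrite -{2}wz; apply: sum_of_mull.
move=> _ [k [v [p [u [q [_ ->]]]]]]; rewrite -nscaleAr nmulA vert_pathL.
case: eqP => [<-|_]; last by rewrite nmul0l scaler0; exact: sum_of0.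
have [pp|np] := boolP (is_path w p); last first.
  by rewrite pathL_invalid // nmul0l scaler0; exact: sum_of0.
have [pq|nq] := boolP (is_path u q); last first.
  by rewrite (ghostL_invalid F nq) nmul0r scaler0; exact: sum_of0.
have [pq_end|pq_end] := eqVneq (pend w p) (pend u q).
  by apply: sum_of1; exists k, p, u, q.
by rewrite pathL_ghostL_neq // scaler0; exact: sum_of0.
Qed.

(** Ghost parts with incomparable paths are killed. If one path is a prefix of the other, the excess
    [r] cancels, by [r^* r] or by [rr^*]; the latter is a vertex because [r] starts on the cycle. *)
Lemma corner_monomial_proj p u q x : corner_monomial x ->
  is_path w p -> is_path u q -> pend w p = pend u q ->
  x ** (pathL u q ** ghostL u q) = 0 \/ x ** (pathL u q ** ghostL u q) = x.
Proof.
move=> [k [p' [v [q' [pp' pq' e' ->]]]]] pp pq e.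
have p'C := on_cycle_pend wC pp'; have pC := on_cycle_pend wC pp.
rewrite -nscaleAl -nmulA.
have [vu|vu] := eqVneq v u; last first.
  left; rewrite [ghostL v q' ** _]nmulA -(pathL_start F u) [ghostL v q' ** _]nmulA ghostL_vert.
  by rewrite (negPf vu) !(nmul0l, nmul0r) scaler0.
subst v; have [q0|[r qr]|[r qr]] := ghostL_pathL_compare F u q' q.
- by left; rewrite [ghostL u q' ** _]nmulA q0 !(nmul0l, nmul0r) scaler0.
- right; rewrite [ghostL u q' ** _]nmulA {1}qr ghost_path_cancel // qr ghostL_cat.
  rewrite [_ ** (ghostL _ r ** _)]nmulA cycle_pathL_ghostL -?e' // ?e' ?ghostL_end //.
  by move: pq; rewrite qr is_path_cat => /andP[].
right; rewrite [ghostL u q' ** _]nmulA {1}qr ghost_path_cancelr //.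
by rewrite -ghostL_cat -qr.
Qed.

(* Every term of [z] is fixed or killed by [q q^*] for the ghost part [q^*] of its
   first term, and that projection factors through [w]. *)
Lemma corner_decomp z : V w ** z = z ->
  exists s : seq (L * L), z = \sum_(b <- s) z ** b.1 ** V w ** b.2.
Proof.
move=> /corner_spanned[l lM ->] {z}.
have [n] := ubnP (size l); elim: n l lM => // n IH [|m l] lM /ltnSE sl.
  by exists [::]; rewrite !big_nil.
have [k [p [u [q [pp pq e mE]]]]] := lM m (mem_head _ _).
have [r [rp re]] := on_cycle_return wC pp.
set z := \sum_(m <- _) m; set E := pathL u q ** ghostL u q.
have mEE : m ** E = m.
  rewrite mE /E -nscaleAl -nmulA [ghostL u q ** _]nmulA ghost_pathL // -e.
  by rewrite nmulA pathL_end.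
have proj x : x \in l -> x ** E = 0 \/ x ** E = x.
  move=> xl; apply: corner_monomial_proj pp pq e; apply: lM.
  by rewrite inE xl orbT.
(* What remains after the projection are exactly the terms killed by [E]; the first term is gone, so
   the list is shorter. *)
have zE : z - z ** E = \sum_(x <- [seq x <- l | x ** E == 0]) x.
  rewrite /z nmul_suml -sumrB big_cons mEE subrr add0r big_filter.
  rewrite [RHS]big_mkcond /= [LHS]big_seq [RHS]big_seq; apply: eq_bigr => x /proj.
  by case=> ->; rewrite ?eqxx ?subr0 // subrr; case: eqP.
have [||s sE] := IH [seq x <- l | x ** E == 0].
- by move=> x; rewrite mem_filter => /andP[_ xl]; apply: lM; rewrite inE xl orbT.
- by apply: leq_trans sl; rewrite ltnS size_filter count_size.
(* The first pair writes [E = qq^*] as [qr w (qr)^*]. The other pairs come from the decomposition of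
   [z - zE], with [1 - E] moved into their left components. *)
exists ((pathL u (q ++ r), ghostL u (q ++ r)) :: [seq (b.1 - E ** b.1, b.2) | b <- s]).
rewrite big_cons big_map /=.
have <- : z ** E = z ** pathL u (q ++ r) ** V w ** ghostL u (q ++ r).
  have endw : pend u (q ++ r) = w by rewrite pend_cat -e.
  have := pathL_end F u (q ++ r); rewrite endw -!nmulA [pathL _ _ ** (V w ** _)]nmulA => ->.
  have rr : pathL (pend u q) r ** ghostL (pend u q) r = V (pend u q).
    by rewrite -e cycle_pathL_ghostL //; exact: on_cycle_pend wC pp.
  by rewrite /E pathL_cat ghostL_cat -!nmulA [pathL _ r ** _]nmulA rr ghostL_end.
rewrite -[LHS](subrK (z ** E)) addrC; congr (_ + _); rewrite zE sE -zE.
by apply: eq_bigr => b _; rewrite nmulBl nmulBr nmulA.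
Qed.

(** [corner_decomp] reduces the claim to elements of the corner; after clearing denominators it says
    that [F[X]] has no zero divisors. *)
Lemma corner_pev_inj f z : f != 0 -> V w ** z = z -> pev f ** z = 0 -> z = 0.
Proof.
move=> f0 wz fz; have [s ->] := corner_decomp wz.
rewrite big1 // => b _; set t := z ** b.1.
suff -> : t ** V w = 0 by rewrite nmul0l.
have [n [h hE]] := corner_poly t.
have tw : V w ** t = t by rewrite /t nmulA wz.
have h0 : h = 0.
  have : pev (f * h) = 0 by rewrite pevM -hE tw /t !nmulA fz !nmul0l.
  by move/pev_eq0/eqP; rewrite mulf_eq0 (negPf f0) => /eqP.
by rewrite -(CpowK n) nmulA -[t]tw hE h0 pev0 nmul0l.
Qed.

Lemma corner_inj g z : g != 0 -> V w ** g = g -> g ** V w = g ->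
  V w ** z = z -> g ** z = 0 -> z = 0.
Proof.
move=> g0 wg gw wz gz; have [n [f fE]] := corner_poly g; rewrite wg in fE.
have gK : g = pev f ** Cinv n by rewrite -fE -nmulA CpowK.
have f0 : f != 0 by apply: contra_neq g0 => f0; rewrite gK f0 pev0 nmul0l.
have Iz : Cinv n ** Cpow n = V w.
  by have [pn en] := cpow_closed n; rewrite /Cinv /Cpow ghost_pathL // en.
have zK : z = Cpow n ** (Cinv n ** z) by rewrite nmulA CpowK.
rewrite zK (@corner_pev_inj f (Cinv n ** z)) ?nmul0r //.
  by rewrite nmulA Cinv_start.
by rewrite nmulA -gK.
Qed.

(* [w L w] is the Laurent polynomial ring in the cycle, hence a principal ideal
   domain. *)
Lemma corner_principal (I : L -> Prop) :
  (forall x y, I x -> I y -> I (x - y)) -> (forall x a, I x -> I (x ** a)) ->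
  (forall x, I x -> V w ** x = x) -> (exists2 x, I x & x != 0) ->
  exists g, [/\ I g, g != 0, g ** V w = g & forall y, I y -> exists z, y = g ** z].
Proof.
move=> IB IM Iw [x Ix x0].
(* Some [x b w] is nonzero, as otherwise [corner_decomp] would give [x = 0]; a power of the cycle
   then turns it into a polynomial without leaving [I]. *)
have [f0 [If0 f00]] : exists f, I (pev f) /\ f != 0.
  have [s sE] := corner_decomp (Iw x Ix).
  have [b b0] : exists b : L * L, x ** b.1 ** V w != 0.
    apply: contrapT => nb; case/eqP: x0; rewrite sE big1 // => b _.
    have -> : x ** b.1 ** V w = 0 by apply/eqP/negPn/negP => b0; apply: nb; exists b.
    exact: nmul0l.
  have [n [f fE]] := corner_poly (x ** b.1).
  exists f; rewrite -fE; split; first by rewrite (nmulA (V w)) (Iw x Ix) -nmulA; exact: IM.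
  apply: contra_neq b0 => f0; rewrite -(CpowK n) nmulA.
  have -> : x ** b.1 = V w ** (x ** b.1) by rewrite nmulA Iw.
  by rewrite fE f0 pev0 nmul0l.
have ex : exists n, `[< exists f, [/\ I (pev f), f != 0 & size f = n] >].
  by exists (size f0); apply/asboolP; exists f0.
case: (ex_minnP ex) => _ /asboolP[f [If fn0 <-]] min.
exists (pev f); split=> //; last 1 first.
- move=> y Iy; have [s sE] := corner_decomp (Iw y Iy).
  suff /choice[z zP] : forall b : L * L, exists z, y ** b.1 ** V w = pev f ** z.
    exists (\sum_(b <- s) z b ** b.2); rewrite nmul_sumr {1}sE.
    by apply: eq_bigr => b _; rewrite nmulA -zP.
  move=> b; have [n [h hE]] := corner_poly (y ** b.1).
  have yb : V w ** (y ** b.1) = y ** b.1 by rewrite nmulA Iw.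
  rewrite yb in hE.
  (* The remainder stays in [I] and is shorter than [f], so minimality makes it zero. *)
  have hf : h %% f = 0.
    apply/eqP/negPn/negP => r0.
    have : I (pev (h %% f)).
      have -> : h %% f = h - f * (h %/ f).
        by rewrite {2}(divp_eq h f) mulrC addrC addKr.
      rewrite pevD pevN pevM; apply: IB; last exact: IM.
      by rewrite -hE; apply/IM/IM.
    move=> Ir; have := ltn_modp h f; rewrite fn0 ltnNge => /negP; apply.
    by apply: min; apply/asboolP; exists (h %% f).
  exists (pev (h %/ f) ** Cinv n).
  by rewrite nmulA -pevM mulrC -[_ * _]addr0 -hf -divp_eq -hE -[RHS]nmulA CpowK.
- by apply: contra_neq fn0 => /pev_eq0.
exact: pev_end.
Qed.

(** With [c] the cycle, [1 - c] generates a proper right ideal: an equation [(1 - c) y = w] would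
    become [(1 - X) h = X^n], which fails at [X = 1]. *)
Lemma corner_not_simple : exists x z, [/\ V w ** x = x, x != 0, V w ** z = z &
  forall y, x ** y <> z].
Proof.
exists (pev (1 - 'X)), (V w); split.
- exact: pev_start.
- have X1 : 1 - 'X != 0 :> {poly F} by rewrite -oppr_eq0 opprB -polyC1 polyXsubC_eq0.
  by apply: contra_neq X1; exact: pev_eq0.
- exact: vert_idem.
move=> y xy; have [n [h hE]] := corner_poly y.
have : pev ((1 - 'X) * h) = pev 'X^n.
  by rewrite pevM -hE pevXn !nmulA pev_end xy Cpow_start.
move=> E; have /pev_eq0 : pev ((1 - 'X) * h - 'X^n) = 0.
  by rewrite pevD pevN E subrr.
move/(congr1 (fun f => f.[1])); rewrite !hornerE subrr mul0r expr1n sub0r.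
by move/eqP; rewrite oppr_eq0 oner_eq0.
Qed.

End CycleCorner.

(** * Modules *)

Section Modules.
Variables (F : fieldType) (A : nuAlgType F).
Implicit Types M N P : rmodType A.

Lemma ract0l M (a : A) : ract (0 : M) a = 0.
Proof. by have := ractZl (0 : F) (0 : M) a; rewrite !scale0r. Qed.

Lemma ract0r M (x : M) : ract x (0 : A) = 0.
Proof. by have := ractZr (0 : F) x (0 : A); rewrite !scale0r. Qed.

Lemma ract_suml M I (s : seq I) (f : I -> M) (a : A) :
  ract (\sum_(i <- s) f i) a = \sum_(i <- s) ract (f i) a.
Proof. by apply: (big_morph (fun x => ract x a)) => [x y|]; rewrite ?ractDl ?ract0l. Qed.

Lemma ract_sumr M I (s : seq I) (f : I -> A) (x : M) :
  ract x (\sum_(i <- s) f i) = \sum_(i <- s) ract x (f i).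
Proof. by apply: (big_morph (fun a => ract x a)) => [a b|]; rewrite ?ractDr ?ract0r. Qed.

Lemma linear_map (U W : lmodType F) (f : U -> W) :
  linear f -> {g : {linear U -> W} | g =1 f}.
Proof.
move=> fl; pose m := GRing.isLinear.Build F U W *:%R f fl.
by pose g : {linear U -> W} := HB.pack f m; exists g.
Qed.

Lemma inj_surj_bij (T U : Type) (f : T -> U) :
  injective f -> (forall y, exists x, f x = y) -> bijective f.
Proof.
move=> fI /choice[g gK]; exists g => // x; exact/fI/gK.
Qed.

Lemma module_iso_refl M : module_iso M M.
Proof.
have [f fE] : {g : {linear M -> M} | g =1 id} by apply: linear_map.
exists f; first by move=> x a; rewrite !fE.
by exists id => x; rewrite fE.
Qed.

Lemma module_iso_sym M N : module_iso M N -> module_iso N M.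
Proof.
move=> [f fH [g fK gK]].
have gl : linear g.
  by move=> k x y; apply: (can_inj fK); rewrite linearP !gK.
have [h hE] := linear_map gl; exists h.
  by move=> x a; rewrite !hE; apply: (can_inj fK); rewrite fH !gK.
by exists f => x; rewrite hE.
Qed.

Lemma module_iso_trans M N P : module_iso M N -> module_iso N P -> module_iso M P.
Proof.
move=> [f fH fb] [g gH gb].
have gfl : linear (g \o f) by move=> k x y /=; rewrite !linearP.
have [h hE] := linear_map gfl; exists h.
  by move=> x a; rewrite !hE /= fH gH.
by apply: (eq_bij (bij_comp gb fb)) => x; rewrite hE.
Qed.

Lemma iso_class_eq M N : module_iso M N -> iso_class M = iso_class N.
Proof.
move=> MN; apply: funext => P; apply: propext; split=> [MP|NP].
  exact: module_iso_trans (module_iso_sym MN) MP.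
exact: module_iso_trans MN NP.
Qed.

Lemma iso_class_inj M N : iso_class M = iso_class N -> module_iso M N.
Proof. by move=> E; rewrite -/(iso_class M N) E; exact: module_iso_refl. Qed.

Lemma submodule_preim M N (f : {linear M -> N}) (S : N -> Prop) :
  module_hom f -> submodule S -> submodule (fun x => S (f x)).
Proof.
move=> fH [S0 SD SZ SA]; split=> [|x y Sx Sy|k x Sx|x a Sx].
- by rewrite linear0.
- by rewrite linearD; exact: SD.
- by rewrite linearZ; exact: SZ.
- by rewrite fH; exact: SA.
Qed.

Lemma set_bij_preim_0 M N (f : {linear M -> N}) (S : N -> Prop) : bijective f ->
  (fun x => S (f x)) = [set 0]%classic :> (M -> Prop) -> S = [set 0]%classic :> (N -> Prop).
Proof.
move=> [g fK gK] E; apply: funext => y; have := congr1 (@^~ (g y)) E.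
rewrite /= gK => ->; apply: propext; split=> [gy|->]; rewrite /set1 /=.
  by rewrite -(gK y) gy linear0.
by rewrite -(linear0 f) fK.
Qed.

Lemma simple_iso M N : module_iso M N -> simple M -> simple N.
Proof.
move=> [f fH fb] [[x x0] Ms]; have [g fK gK] := fb; split.
  by exists (f x); apply: contra_neq x0 => fx; rewrite -(fK x) fx -(linear0 f) fK.
move=> S Ssub; case: (Ms _ (submodule_preim fH Ssub)) => E; [left|right].
  exact: set_bij_preim_0 fb E.
apply: funext => y; rewrite -(gK y).
by have := congr1 (@^~ (g y)) E.
Qed.

Lemma indecomposable_iso M N : module_iso M N -> indecomposable M -> indecomposable N.
Proof.
move=> [f fH fb] [[x x0] Mi]; have [g fK gK] := fb; split.
  by exists (f x); apply: contra_neq x0 => fx; rewrite -(fK x) fx -(linear0 f) fK.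
move=> S T Ssub Tsub ST ST0.
case: (Mi _ _ (submodule_preim fH Ssub) (submodule_preim fH Tsub)).
- move=> y; have [u [v [Su Tv fy]]] := ST (f y).
  by exists (g u), (g v); rewrite !gK; split=> //; apply: (can_inj fK); rewrite linearD !gK.
- apply: funext => y; apply: propext; split=> [[Sy Ty]|->].
    have : (S `&` T)%classic (f y) by [].
    by rewrite ST0 => fy; apply: (can_inj fK); rewrite linear0.
  have : (S `&` T)%classic 0 by rewrite ST0.
  by rewrite -(linear0 f).
- by move=> E; left; exact: set_bij_preim_0 fb E.
by move=> E; right; exact: set_bij_preim_0 fb E.
Qed.

End Modules.

(** * Modules generated by a vertex *)

Section LeavittModules.
Variables (F : fieldType) (G : digraph).
Local Notation L := (LPA F G).
Implicit Types (v u w : vertex G) (e f : arrow G) (p q : seq (arrow G)) (a b : L).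
Implicit Types (M P : rmodType L).

Local Notation V := (lpa_vert F).
Local Notation pathL := (pathL F).
Local Notation ghostL := (ghostL F).

Lemma support_iso M N : module_iso M N -> support M = support N :> (vertex G -> Prop).
Proof.
suff sub M' N' : module_iso M' N' -> forall v, support M' v -> support N' v.
  move=> MN; apply: funext => v; apply: propext; split; apply: sub => //.
  exact: module_iso_sym.
move=> [f fH [g fK gK]] v [x xv]; exists (f x).
by rewrite -fH; apply: contra_neq xv => fx; rewrite -(fK (ract x _)) fx -(linear0 f) fK.
Qed.

Lemma vert_idealP v a : reflect (V v ** a = a) (a \in vert_ideal v).
Proof.
apply: (iffP idP) => [/asboolP[b ->]|va]; last by apply/asboolP; exists a.
by rewrite nmulA vert_idem.
Qed.

Definition to_vL v a (va : V v ** a = a) : vL F v := VertModule (introT (vert_idealP v a) va).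

Lemma vL_start v (x : vL F v) : V v ** val x = val x.
Proof. exact/vert_idealP/(valP x). Qed.

Lemma vL_ract v (x : vL F v) a : val (ract x a) = val x ** a.
Proof. by []. Qed.

Definition vL_gen v : vL F v := to_vL (vert_idem F v).

Lemma vL_gen_ract v (x : vL F v) : ract (vL_gen v) (val x) = x.
Proof. by apply: val_inj; rewrite vL_ract /= vL_start. Qed.

Lemma vL_nontrivial v : nontrivial (vL F v).
Proof.
exists (vL_gen v); apply: contra_neq (lpa_vert_neq0 F v) => g0.
by rewrite -[V v]/(val (vL_gen v)) g0.
Qed.

Lemma vL_finitely_generated v : finitely_generated (vL F v).
Proof.
exists [:: vL_gen v] => S [_ _ _ SA] Sg; apply: funext => x; apply: propext.
by split=> // _; rewrite -(vL_gen_ract x); apply/SA/Sg; rewrite mem_head.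
Qed.

(** Lift the image of the generator to any [m] and let [x] go to [m x]. *)
Lemma vL_projective v : projective (vL F v).
Proof.
move=> M N g f gH fH gS; have [m gm] := gS (f (vL_gen v)).
have hl : linear (fun x : vL F v => ract m (val x)).
  by move=> k x y; rewrite linearP ractDr ractZr.
have [h hE] := linear_map hl; exists h => [x a|x]; rewrite !hE.
  by rewrite vL_ract ractA.
by rewrite gH gm -fH vL_gen_ract.
Qed.

(** Left multiplications by [p^*] and by [p] are mutually inverse, since both [p^* p] and [pp^*] are
    vertices here. *)
Lemma vL_iso v p : unbranched v -> is_path v p -> module_iso (vL F v) (vL F (pend v p)).
Proof.
move=> vU pp; set u := pend v p.
have to_u (x : vL F v) : V u ** (ghostL v p ** val x) = ghostL v p ** val x.
  by rewrite nmulA ghostL_end.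
have to_v (x : vL F u) : V v ** (pathL v p ** val x) = pathL v p ** val x.
  by rewrite nmulA pathL_start.
have fl : linear (fun x : vL F v => to_vL (to_u x)).
  by move=> k x y; apply: val_inj; rewrite /= nmulDr nscaleAr.
have [f fE] := linear_map fl; exists f.
  by move=> x a; rewrite !fE; apply: val_inj; rewrite /= nmulA.
exists (fun x => to_vL (to_v x)) => x; rewrite fE; apply: val_inj => /=.
  by rewrite nmulA pathL_ghostL // vL_start.
by rewrite nmulA ghost_pathL // vL_start.
Qed.

Lemma ghostL_pathL_rcons v p e f : is_path v p -> e != f ->
  ghostL v (rcons p e) ** pathL v (rcons p f) = 0.
Proof.
move=> pp /negPf ef; rewrite -!cats1 ghostL_cat -nmulA ghost_path_cancel //.
rewrite ghostL1 pathL1 -nmulA [V _ ** (V _ ** _)]nmulA vert_idem vert_arr.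
by case: eqP => _; rewrite ?ghost_arr ?ef ?nmul0r.
Qed.

Lemma indecomposable_unbranched v : indecomposable (vL F v) -> unbranched v.
Proof.
move=> [_ vI] p e f pp ev fv; apply/eqP/negPn/negP => ef.
have pe : is_path v (rcons p e) by rewrite is_path_rcons pp ev /=.
have pf : is_path v (rcons p f) by rewrite is_path_rcons pp fv /=.
set q := rcons p e in pe; set E := pathL v q ** ghostL v q.
have EE : E ** E = E.
  by rewrite /E -nmulA [ghostL v q ** _]nmulA ghost_pathL // ghostL_end.
have vE : V v ** E = E by rewrite /E nmulA pathL_start.
(* The images of [E] and [1 - E]. Neither is zero: [E] itself lies in the first, and the path [p]
   followed by [f] in the second. *)
pose S (x : vL F v) := E ** val x = val x; pose T (x : vL F v) := E ** val x = 0.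
case: (vI S T).
- split=> [|x y Sx Sy|k x Sx|x a Sx]; rewrite /S.
  + by rewrite linear0 nmul0r.
  + by rewrite linearD nmulDr Sx Sy.
  + by rewrite linearZ -nscaleAr Sx.
  + by rewrite vL_ract nmulA Sx.
- split=> [|x y Sx Sy|k x Sx|x a Sx]; rewrite /T.
  + by rewrite linear0 nmul0r.
  + by rewrite linearD nmulDr Sx Sy addr0.
  + by rewrite linearZ -nscaleAr Sx scaler0.
  + by rewrite vL_ract nmulA Sx nmul0l.
- move=> x; have vEx : V v ** (E ** val x) = E ** val x by rewrite nmulA vE.
  exists (to_vL vEx), (x - to_vL vEx); split; last by rewrite addrC subrK.
    by rewrite /S /= nmulA EE.
  by rewrite /T linearB /= nmulBr nmulA EE subrr.
- apply: funext => x; apply: propext; split=> [[Sx Tx]|->]; last first.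
    by split; rewrite /S /T linear0 nmul0r.
  by apply: val_inj; rewrite -Sx Tx.
- move=> /(congr1 (@^~ (to_vL vE))) /= S0.
  have : S (to_vL vE) by rewrite /S /= EE.
  rewrite S0 => /(congr1 val) /= E0.
  have := pathL_neq0 F pe; rewrite -(pathL_end F v q) -ghost_pathL //.
  by rewrite nmulA -/E E0 nmul0l eqxx.
move=> /(congr1 (@^~ (to_vL (pathL_start F v (rcons p f))))) /= T0.
have : T (to_vL (pathL_start F v (rcons p f))).
  by rewrite /T /= /E /q -nmulA ghostL_pathL_rcons // nmul0r.
rewrite T0 => /(congr1 val) /= f0.
by have := pathL_neq0 F pf; rewrite f0 eqxx.
Qed.

(** With cycles excluded, the reduction gives [p^* x b = pend v p]. As [pp^* = v], this says
    [v = x b p^*], so [x] generates the module. *)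
Lemma vL_simple v : unbranched v -> (forall p, is_path v p -> ~ on_cycle (pend v p)) ->
  simple (vL F v).
Proof.
move=> vU vC; split; first exact: vL_nontrivial.
move=> S [S0 SD SZ SA].
have [[x [Sx x0]]|nS] := pselect (exists x, S x /\ x != 0); last first.
  left; apply: funext => x; apply: propext; split=> [Sx|-> //].
  by apply/eqP/negPn/negP => x0; apply: nS; exists x.
right; apply: funext => y; apply: propext; split=> // _.
have vx0 : val x != 0 by apply: contra_neq x0 => x0; exact: val_inj.
have [p [pp [[b bE]|[pC _]]]] := reduction (vL_start x) vx0; last by case: (vC p pp).
have -> : y = ract x (b ** ghostL v p ** val y).
  apply: val_inj; rewrite vL_ract -[val x](vL_start x) -(pathL_ghostL F vU pp).
  rewrite -!nmulA [ghostL v p ** (val x ** _)]nmulA [ghostL v p ** val x ** _]nmulA bE.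
  by rewrite [V _ ** _]nmulA ghostL_end nmulA pathL_ghostL // vL_start.
exact: SA.
Qed.

Lemma vL_cycle_not_simple v : on_cycle v -> ~ simple (vL F v).
Proof.
move=> [c vc ne] [_ vS].
have [a [b [va a0 vb ab]]] := corner_not_simple F vc ne.
pose S (x : vL F v) := exists y, val x = a ** y.
case: (vS S).
- split=> [|x y [x' xE] [y' yE]|k x [x' xE]|x d [x' xE]].
  + by exists 0; rewrite nmul0r linear0.
  + by exists (x' + y'); rewrite /= xE yE nmulDr.
  + by exists (k *: x'); rewrite /= xE nscaleAr.
  + by exists (x' ** d); rewrite vL_ract xE nmulA.
- move=> /(congr1 (@^~ (to_vL va))) /= S0.
  have : S (to_vL va).
    (* A finite sum of vertices replaces the unit, to show that [a] lies in [aL]. *)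
    have [s _ aE] := vert_right a; exists (\sum_(u <- s) V u).
    by rewrite nmul_sumr -aE.
  by rewrite S0 => /(congr1 val) /= /eqP; rewrite (negPf a0).
move=> /(congr1 (@^~ (to_vL vb))) /= ST.
have [y /= yE] : S (to_vL vb) by rewrite ST.
by case: (ab y).
Qed.

(** Write the generator as [y' + z'] along the two summands, both cut down to the corner. Then
    [z' y' = y' - y' y'] lies in both summands, so it vanishes, and the corner has no zero divisors:
    one of the summands contains the generator. *)
Lemma vL_cycle_indecomposable v : on_cycle v -> indecomposable (vL F v).
Proof.
move=> [c vc ne]; split; first exact: vL_nontrivial.
move=> S T [S0 SD SZ SA] [T0 TD TZ TA] ST ST0.
have [y [z [Sy Tz yz]]] := ST (vL_gen v).
pose y' := ract y (V v); pose z' := ract z (V v).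
have Sy' : S y' by exact: SA.
have Tz' : T z' by exact: TA.
have yzv : val y' + val z' = V v.
  by rewrite !vL_ract -nmulDl -linearD -yz /= vert_idem.
have zy0 : val z' ** val y' = 0.
  have SN x : S x -> S (- x) by rewrite -scaleN1r; exact: SZ.
  have E : ract z' (val y') = y' - ract y' (val y').
    have zE : val z' = V v - val y' by rewrite -yzv addrC addKr.
    apply: val_inj; rewrite linearB vL_ract zE nmulBl vL_start.
    by rewrite vL_ract.
  have : (S `&` T)%classic (ract z' (val y')).
    by split; [rewrite E; apply/SD/SN/SA | apply: TA].
  by rewrite ST0 => /(congr1 val).
have end_v (x : vL F v) : val (ract x (V v)) ** V v = val (ract x (V v)).
  by rewrite !vL_ract -nmulA vert_idem.
have [z0|z0] := eqVneq (val z') 0; [right|left]; apply: funext => x; apply: propext.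
  split=> [Tx|-> //]; have : (S `&` T)%classic x.
    split=> //; rewrite -(vL_gen_ract x); apply: SA.
    suff -> : vL_gen v = y' by [].
    by apply: val_inj; rewrite -[RHS]addr0 -z0 yzv.
  by rewrite ST0.
have y0 : val y' = 0.
  exact: (corner_inj vc ne z0 (vL_start z') (end_v z) (vL_start y') zy0).
split=> [Sx|-> //]; have : (S `&` T)%classic x.
  split=> //; rewrite -(vL_gen_ract x); apply: TA.
  suff -> : vL_gen v = z' by [].
  by apply: val_inj; rewrite -[RHS]add0r -y0 yzv.
by rewrite ST0.
Qed.

Lemma vL_cycle_fgip v : on_cycle v -> fgip (vL F v).
Proof.
move=> vC; split; first exact: vL_finitely_generated.
  exact: vL_cycle_indecomposable.
exact: vL_projective.
Qed.

Lemma support_vL v u : on_cycle v ->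
  support (vL F v) u <-> exists p q, [/\ is_path v p, is_path u q & pend v p = pend u q].
Proof.
move=> vC; split=> [[x]|[p [q [pp pq e]]]].
  apply: contra_neqP => npq; apply: val_inj; rewrite vL_ract -(vL_start x) /=.
  have [n] := lpa_spanned (val x).
  apply: (sum_of_ind (T := fun a => V v ** a ** V u = 0)) => [|m y].
    by rewrite nmul0r nmul0l.
  move=> [k [v' [p [u' [q [_ ->]]]]]] IH; rewrite nmulDr nmulDl IH addr0.
  rewrite -nscaleAr -nscaleAl nmulA vert_pathL -nmulA ghostL_vert.
  case: eqP => [<-|_]; last by rewrite nmul0l scaler0.
  case: eqP => [->|_]; last by rewrite nmul0r scaler0.
  have [pp|/(pathL_invalid F) ->] := boolP (is_path v p); last by rewrite nmul0l scaler0.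
  have [pq|/(ghostL_invalid F) ->] := boolP (is_path u q); last by rewrite nmul0r scaler0.
  rewrite pathL_ghostL_neq ?scaler0 //; apply/eqP => e; apply: npq.
  by exists p, q.
have va : V v ** (pathL v p ** ghostL u q) = pathL v p ** ghostL u q.
  by rewrite nmulA pathL_start.
exists (to_vL va); apply: contra_neq (lpa_vert_neq0 F (pend v p)) => /(congr1 val).
rewrite vL_ract /= -nmulA ghostL_start => pq0.
have <- : V (pend v p) ** V (pend u q) = V (pend v p) by rewrite -e vert_idem.
rewrite -(ghost_pathL F pp) -(ghost_pathL F pq).
by rewrite -!nmulA [pathL v p ** _]nmulA pq0 nmul0l nmul0r.
Qed.

End LeavittModules.

(** * Finite powers of the algebra as unital right modules *)

Section FreeModule.
Variables (F : fieldType) (G : digraph) (n : nat).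
Local Notation L := (LPA F G).

Definition lpow : Type := {ffun 'I_n -> L}.
HB.instance Definition _ := GRing.Lmodule.on lpow.

Definition lpow_act (x : lpow) (a : L) : lpow := [ffun i => x i ** a].

Lemma lpow_actDl x y a : lpow_act (x + y) a = lpow_act x a + lpow_act y a.
Proof. by apply/ffunP => i; rewrite !ffunE nmulDl. Qed.

Lemma lpow_actDr x a b : lpow_act x (a + b) = lpow_act x a + lpow_act x b.
Proof. by apply/ffunP => i; rewrite !ffunE nmulDr. Qed.

Lemma lpow_actZl (k : F) x a : lpow_act (k *: x) a = k *: lpow_act x a.
Proof. by apply/ffunP => i; rewrite !ffunE nscaleAl. Qed.

Lemma lpow_actZr (k : F) x a : lpow_act x (k *: a) = k *: lpow_act x a.
Proof. by apply/ffunP => i; rewrite !ffunE nscaleAr. Qed.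

Lemma lpow_actA x a b : lpow_act (lpow_act x a) b = lpow_act x (a ** b).
Proof. by apply/ffunP => i; rewrite !ffunE nmulA. Qed.

Lemma lpow_act_unital x :
  exists r : seq (lpow * L), x = \sum_(p <- r) lpow_act p.1 p.2.
Proof.
pose d i : lpow := [ffun j => if j == i then x i else 0].
have xE : x = \sum_(i < n) d i.
  apply/ffunP => j; rewrite sum_ffunE (bigD1 j) //= ffunE eqxx big1 ?addr0 // => i ij.
  by rewrite ffunE eq_sym (negPf ij).
have /choice[s sP] : forall i, exists s : seq (vertex G),
    x i = \sum_(v <- s) x i ** lpa_vert F v.
  by move=> i; have [s _ E] := vert_right (x i); exists s.
exists (flatten [seq [seq (d i, lpa_vert F v) | v <- s i] | i <- enum 'I_n]).
rewrite big_flatten big_map big_enum /= {1}xE; apply: eq_bigr => i _.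
rewrite big_map; apply/ffunP => j; rewrite sum_ffunE ffunE.
case: (eqVneq j i) => [ji|ji]; last first.
  by rewrite big1 // => v _; rewrite !ffunE (negPf ji) nmul0l.
rewrite {1}sP; apply: eq_bigr => v _; rewrite !ffunE.
by rewrite ji eqxx.
Qed.

HB.instance Definition _ := Lmodule_isRightModule.Build F L lpow
  lpow_actDl lpow_actDr lpow_actZl lpow_actZr lpow_actA lpow_act_unital.

End FreeModule.

(** * Finitely generated indecomposable projectives *)

Section Projectives.
Variables (F : fieldType) (G : digraph).
Local Notation L := (LPA F G).
Implicit Types (v u w : vertex G) (P : rmodType L).

Local Notation V := (lpa_vert F).

Lemma ract_local_unit P (x : P) : exists a : L, ract x a = x.
Proof.
suff [s _ xE] : exists2 s : seq (vertex G), uniq s & x = \sum_(v <- s) ract x (V v).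
  by exists (\sum_(v <- s) V v); rewrite ract_sumr -xE.
apply: (orth_decomp (T := fun v x => ract x (V v))).
- by move=> v; exact: ract0l.
- by move=> v y z; exact: ractDl.
- by move=> u v y; rewrite ractA vertM; case: eqP => [->//|_]; exact: ract0r.
have [r ->] := ract_unital x; apply: sum_of_sum => -[y a] /=.
have [s _ ->] := vert_right a; rewrite ract_sumr; apply: sum_of_sum => v.
by apply: sum_of1; exists v; rewrite ractA -nmulA vert_idem.
Qed.

(** Projectivity splits a map from [lpow F G n] onto [P]; some coordinate of the section is nonzero
    at [x]. *)
Lemma projective_separates P (x : P) : finitely_generated P -> projective P -> x != 0 ->
  exists2 phi : {linear P -> L}, (forall y a, phi (ract y a) = phi y ** a) & phi x != 0.
Proof.
move=> [r rgen] Pproj x0; set n := size r.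
pose g (m : lpow F G n) : P := \sum_(i < n) ract (tnth (in_tuple r) i) (m i).
have gl : linear g.
  move=> k m m'; rewrite /g scaler_sumr -big_split; apply: eq_bigr => i _.
  by rewrite !ffunE ractDr ractZr.
have [gL gE] := linear_map gl.
have gH : module_hom gL.
  move=> m a; rewrite !gE /g ract_suml; apply: eq_bigr => i _.
  by rewrite ffunE ractA.
have gS y : exists m, gL m = y.
  suff imT : (fun y => exists m, gL m = y) = setT :> (P -> Prop).
    by have := congr1 (@^~ y) imT => /= ->.
  apply: rgen => [|z /seq_tnthP[i zi]].
    split=> [|_ _ [m <-] [m' <-]|k _ [m <-]|_ a [m <-]].
    - by exists 0; rewrite linear0.
    - by exists (m + m'); rewrite linearD.
    - by exists (k *: m); rewrite linearZ.
    - by exists (ract m a); rewrite gH.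
  (* A local unit of [z] in the [i]-th coordinate plays the part of a basis vector. *)
  have [a za] := ract_local_unit z.
  exists [ffun j => if j == i then a else 0]; rewrite gE /g (bigD1 i) //= ffunE eqxx.
  by rewrite -zi za big1 ?addr0 // => j ij; rewrite ffunE (negPf ij) ract0r.
have [idP idE] : {f : {linear P -> P} | f =1 id} by exact: linear_map.
have idH : module_hom idP by move=> y a; rewrite !idE.
have [h hH hK] := Pproj _ _ gL idP gH idH gS.
have [i hi] : exists i, h x i != 0.
  apply: contrapT => nh; case/eqP: x0; rewrite -[x]idE -hK.
  have -> : h x = 0; last by rewrite linear0.
  by apply/ffunP => i; rewrite ffunE; apply/eqP/negPn/negP => hi; apply: nh; exists i.
have pl : linear (fun y => h y i) by move=> k y z; rewrite linearP !ffunE.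
have [phi phiE] := linear_map pl; exists phi; last by rewrite phiE.
by move=> y a; rewrite !phiE hH ffunE.
Qed.

(** The hypotheses make [x0 L] a complement of the kernel of [psi]. Since [x0] is nonzero the kernel
    must vanish, and [x] going to [x0 x] identifies [wL] with [P]. *)
Lemma indecomposable_split P w (psi : {linear P -> L}) (x0 : P) :
  indecomposable P -> (forall y a, psi (ract y a) = psi y ** a) ->
  ract x0 (V w) = x0 -> x0 != 0 -> (forall y, exists z, psi y = psi x0 ** z) ->
  (forall z, V w ** z = z -> psi x0 ** z = 0 -> z = 0) ->
  module_iso P (vL F w).
Proof.
move=> [_ Pi] psiH x0w x00 psiS psiI.
pose S (y : P) := exists z, y = ract x0 z; pose T (y : P) := psi y = 0.
have x0_split z : ract x0 z = ract x0 (V w ** z) by rewrite -ractA x0w.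
have T0 : T = [set 0]%classic.
  case: (Pi S T) => //.
  - split=> [|_ _ [z ->] [z' ->]|k _ [z ->]|_ a [z ->]].
    + by exists 0; rewrite ract0r.
    + by exists (z + z'); rewrite ractDr.
    + by exists (k *: z); rewrite ractZr.
    + by exists (z ** a); rewrite ractA.
  - split=> [|y z Ty Tz|k y Ty|y a Ty]; rewrite /T.
    + exact: linear0.
    + by rewrite linearD Ty Tz addr0.
    + by rewrite linearZ /= Ty scaler0.
    + by rewrite psiH Ty nmul0l.
  - move=> y; have [z yz] := psiS y; exists (ract x0 z), (y - ract x0 z).
    split; [by exists z| |by rewrite addrC subrK].
    by rewrite /T linearB psiH -yz subrr.
  - apply: funext => y; apply: propext; split=> [[[z ->] Tz]|->]; last first.
      by split; [exists 0; rewrite ract0r | exact: linear0].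
    rewrite /set1 /= x0_split (psiI (V w ** z)) ?ract0r //.
      by rewrite nmulA vert_idem.
    by rewrite -psiH -x0_split.
  move=> /(congr1 (@^~ x0)) /= Sx; have : S x0 by exists (V w).
  by rewrite Sx => /eqP; rewrite (negPf x00).
apply: module_iso_sym.
have fl : linear (fun x : vL F w => ract x0 (val x)).
  by move=> k x y; rewrite linearP ractDr ractZr.
have [f fE] := linear_map fl; exists f.
  by move=> x a; rewrite !fE vL_ract ractA.
apply: inj_surj_bij => [x y|y].
  rewrite !fE => xy; apply: val_inj; apply/eqP; rewrite -subr_eq0; apply/eqP.
  apply: psiI; first by rewrite nmulBr !vL_start.
  by rewrite nmulBr -!psiH xy subrr.
have [z yz] := psiS y.
have wz : V w ** (V w ** z) = V w ** z by rewrite nmulA vert_idem.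
exists (to_vL wz); rewrite fE /= -x0_split; apply/eqP; rewrite -subr_eq0; apply/eqP.
have : T (ract x0 z - y) by rewrite /T linearB psiH yz subrr.
by rewrite T0.
Qed.

Lemma fgip_vL P : fgip P -> exists w, module_iso P (vL F w).
Proof.
move=> [Pfg Pi Pp]; have [[x x0] _] := Pi.
have [phi phiH phix] := projective_separates Pfg Pp x0.
have [v vx] := vert_left_neq0 phix.
have vvx : V v ** (V v ** phi x) = V v ** phi x by rewrite nmulA vert_idem.
have [p [pp red]] := reduction vvx vx; exists (pend v p); set w := pend v p in red *.
have psil : linear (fun y => ghostL F v p ** phi y).
  by move=> k y z; rewrite linearP nmulDr nscaleAr.
have [psi psiE] := linear_map psil.
have psiH y a : psi (ract y a) = psi y ** a by rewrite !psiE phiH nmulA.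
have psiw y : V w ** psi y = psi y by rewrite psiE nmulA ghostL_end.
rewrite nmulA ghostL_start -psiE in red.
case: red => [[b bE]|[wC psix]].
  (* Here [psi] attains the vertex [w] itself, which acts as the identity on [wL]. *)
  have gen : psi (ract x (b ** V w)) = V w by rewrite psiH nmulA bE vert_idem.
  apply: (@indecomposable_split P w psi (ract x (b ** V w))) => //.
  - by rewrite ractA -nmulA vert_idem.
  - by apply: contra_neq (lpa_vert_neq0 F w) => x'0; rewrite -gen x'0 linear0.
  - by move=> y; exists (psi y); rewrite gen psiw.
  - by move=> z wz; rewrite gen wz.
have [c wc ne] := wC.
(* The image of [psi] is a nonzero right ideal inside [wL]. Its generator [g] is a value [psi y],
   and [y] may be replaced by [y w] because [g w = g]. *)
pose I a := exists y, a = psi y.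
have [||||g [[y gy] g0 gw gS]] := @corner_principal F G w c wc ne I.
- by move=> _ _ [y ->] [z ->]; exists (y - z); rewrite linearB.
- by move=> _ a [y ->]; exists (ract y a); rewrite psiH.
- by move=> _ [y ->].
- by exists (psi x) => //; exists x.
have gE : psi (ract y (V w)) = g by rewrite psiH -gy gw.
apply: (@indecomposable_split P w psi (ract y (V w))) => //.
- by rewrite ractA vert_idem.
- by apply: contra_neq g0 => y0; rewrite -gE y0 linear0.
- by move=> z; rewrite gE; apply: gS; exists z.
by move=> z wz; rewrite gE; apply: (corner_inj wc ne g0 _ gw wz); rewrite gy.
Qed.

Lemma fgip_not_simple P : fgip P -> ~ simple P ->
  exists2 v, on_cycle v & module_iso P (vL F v).
Proof.
move=> Pf Pns; have [w Pw] := fgip_vL Pf.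
have wU : unbranched w.
  by apply: indecomposable_unbranched; apply: indecomposable_iso Pw _; case: Pf.
have [[p [pp pC]]|nC] := pselect (exists p, is_path w p /\ on_cycle (pend w p)).
  by exists (pend w p) => //; exact: module_iso_trans Pw (vL_iso F wU pp).
case: Pns; apply: (simple_iso (module_iso_sym Pw)); apply: vL_simple => // p pp pC.
by apply: nC; exists p.
Qed.

End Projectives.

(** * Cycles and paths in a full subgraph *)

Section FullSubgraph.
Variables (G : digraph) (S : set (vertex G)).
Local Notation H := (full_subgraph S).

Lemma is_cycle_subgraph (D : seq (arrow H)) : is_cycle (subgraph_path D) = is_cycle D.
Proof.
congr [&& _, _ & _]; first by case: D.
  case: D => [//|e D]; rewrite /= -map_rcons path_map; apply: eq_path => f g.
  by rewrite /= -[in RHS]val_eqE.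
by rewrite -(map_inj_uniq (@val_inj _ _ (vertex H))) /subgraph_path -!map_comp.
Qed.

Lemma on_path_subgraph (v : vertex H) (D : seq (arrow H)) :
  on_path (val v) (subgraph_path D) = on_path v D.
Proof.
rewrite /on_path /subgraph_path -!map_comp -!(mem_map (@val_inj _ _ (vertex H))).
by rewrite -!map_comp.
Qed.

(** An exit in the subgraph is an exit in the whole graph. The converse can fail, as an exit may
    lead out of [S]; uniqueness of the cycle in the support is therefore argued inside the
    subgraph. *)
Lemma no_exit_cycle_subgraph (D : seq (arrow H)) :
  no_exit_cycle (subgraph_path D) -> no_exit_cycle D.
Proof.
rewrite /no_exit_cycle is_cycle_subgraph => -[cD nD]; split=> // e.
apply: contra (nD (val e)) => /andP[eD sD]; apply/andP; split.
  by rewrite (mem_map val_inj).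
by have := on_path_subgraph (src e) D; rewrite sD.
Qed.

Lemma lift_path (u : vertex H) q : is_path (val u) q ->
  (forall e, e \in q -> (src e \in S) && (tgt e \in S)) ->
  exists q' : seq (arrow H), [/\ is_path u q', val (pend u q') = pend (val u) q &
    subgraph_path q' = q].
Proof.
elim: q u => [|e q IH] u /=; first by exists [::].
move=> /andP[/eqP eu pq] qS; pose e' : arrow H := exist _ e (qS e (mem_head _ _)).
have [|q' [pq' q'e q'E]] := IH (tgt e') pq.
  by move=> f fq; rewrite qS // inE fq orbT.
exists (e' :: q'); rewrite /= pq' q'E; split=> //.
by rewrite andbT -val_eqE /= eu.
Qed.

End FullSubgraph.

(** * The correspondence between cycles and modules *)

Section CycleCorrespondence.
Variables (F : fieldType) (G : digraph).
Local Notation L := (LPA F G).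
Implicit Types (v u : vertex G) (c d p q : seq (arrow G)) (P : rmodType L).

Lemma no_exit_on_cycle c v : no_exit_cycle c -> on_path v c -> on_cycle v.
Proof. by move=> cn vc; apply/on_cycleP; exists c. Qed.

Lemma cycle_vL_iso c v u : no_exit_cycle c -> on_path v c -> on_path u c ->
  module_iso (vL F v) (vL F u).
Proof.
move=> cn vc uc; have [n nc ne] := no_exit_cycle_rot cn vc.
have uc' : u \in map (@src G) (rot n c).
  by rewrite map_rot mem_rot -on_cycle_src //; case: cn.
have [p pp <-] := from_cycle_path nc uc'.
by apply: vL_iso => //; apply/on_cycle_unbranched/(no_exit_on_cycle cn).
Qed.

(** The support is an isomorphism invariant. It contains [u], so paths from [v] and [u] meet, at a
    vertex that lies on both cycles. *)
Lemma vL_iso_cycle_class c d v u : no_exit_cycle c -> no_exit_cycle d ->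
  on_path v c -> on_path u d -> module_iso (vL F v) (vL F u) ->
  cycle_class c = cycle_class d.
Proof.
move=> cn dn vc ud vu; have vC := no_exit_on_cycle cn vc; have uC := no_exit_on_cycle dn ud.
have : support (vL F u) u by apply/(support_vL F u uC); exists [::], [::].
rewrite -(support_iso vu) => /(support_vL F u vC)[p [q [pp pq e]]].
by apply: (no_exit_cycle_meet cn dn vc pp); rewrite e; exact: no_exit_cycle_pend dn ud pq.
Qed.

(** Defined on arbitrary sets of lists by quantifying over a representative and a vertex; on a cycle
    class, [cycle_module_classE] shows that neither choice matters. *)
Definition cycle_module_class (C : set (seq (arrow G))) : rmodType L -> Prop :=
  fun N => exists c v, [/\ C c, no_exit_cycle c, on_path v c & module_iso (vL F v) N].

Lemma cycle_module_classE c v : no_exit_cycle c -> on_path v c ->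
  cycle_module_class (cycle_class c) = iso_class (vL F v).
Proof.
move=> cn vc; apply: funext => N; apply: propext; split=> [[d [u [cd dn ud uN]]]|vN].
  apply: module_iso_trans uN; apply: (cycle_vL_iso cn vc).
  case: cd ud dn => n -> uc dn; move: uc; rewrite !on_cycle_src ?map_rot ?mem_rot //.
    by case: cn.
  by case: dn; rewrite ?map_rot.
by exists c, v; split=> //; exists 0%N; rewrite rot0.
Qed.

Lemma support_cycle P v c : module_iso P (vL F v) -> no_exit_cycle c -> on_path v c ->
  exists D : seq (arrow (support_subgraph P)),
    [/\ no_exit_cycle D,
        forall D' : seq (arrow (support_subgraph P)),
          no_exit_cycle D' -> cycle_class D' = cycle_class D &
        subgraph_path D = c].
Proof.
move=> Pv cn vc; have vC := no_exit_on_cycle cn vc.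
have suppP u : u \in support P <->
    exists p q, [/\ is_path v p, is_path u q & pend v p = pend u q].
  by rewrite in_setE (support_iso Pv); exact: support_vL.
(* Every vertex along [q] still reaches the meeting point by the rest of [q], hence is in the
   support. *)
have arrow_supp u p q e : is_path v p -> is_path u q -> pend v p = pend u q -> e \in q ->
    (src e \in support P) && (tgt e \in support P).
  move=> pp + + /splitPr eq; case: eq => q1 q2; rewrite is_path_cat pend_cat /=.
  move=> /and3P[_ /eqP eu pq2] pe; apply/andP; split; apply/suppP.
    by exists p, (e :: q2); split; rewrite //= ?eqxx // pe -eu.
  by exists p, q2.
have [n nc ne] := no_exit_cycle_rot cn vc.
have c_supp e : e \in c -> (src e \in support P) && (tgt e \in support P).
  have [_ [_ [_ _ pc ce _]]] := nc.
  by rewrite -(mem_rot n); apply: (arrow_supp v [::]).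
have [D DE] : exists D : seq (arrow (support_subgraph P)), subgraph_path D = c.
  elim: (c) c_supp => [|e s IH] sS; first by exists [::].
  have [|D DE] := IH; first by move=> f fs; apply: sS; rewrite inE fs orbT.
  by exists (exist _ e (sS e (mem_head _ _)) :: D); rewrite /= DE.
have Dn : no_exit_cycle D by apply: no_exit_cycle_subgraph; rewrite DE.
exists D; split=> // D' D'n.
(* [D'] may have exits in [G]. But its vertex [u] is in the support, so a path from [u] reaches [D].
   That path stays in the support, lifts to the subgraph, and cannot leave [D'] there. *)
have [cD' _] := D'n; have /is_cycleP[u uD'] := cD'.
have uD'p : on_path u D'.
  by rewrite on_cycle_src //; case: uD' => [e [s [-> <- _ _ _]]]; exact: mem_head.
have /suppP[p [q [pp pq e]]] := valP u.
have [f fq|q' [pq' q'e _]] := lift_path pq; first exact: arrow_supp pp pq e fq.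
apply: (no_exit_cycle_meet D'n Dn uD'p pq').
by rewrite -on_path_subgraph q'e DE -e; exact: no_exit_cycle_pend.
Qed.

End CycleCorrespondence.

Theorem theorem21 (F : fieldType) (G : digraph) :
  (forall P : rmodType (LPA F G), fgip P -> ~ simple P ->
     exists v : vertex G,
       (exists c : seq (arrow G), no_exit_cycle c /\ on_path v c) /\
       module_iso P (vL F v)) /\
  exists Phi : set (seq (arrow G)) -> (rmodType (LPA F G) -> Prop),
    [/\ bijective_between (@no_exit_cycle_classes G)
         (@nonsimple_fgip_classes F G) Phi,
        (forall (c : seq (arrow G)) (v : vertex G),
           no_exit_cycle c -> on_path v c ->
           Phi (cycle_class c) = iso_class (vL F v)) &
        (forall P : rmodType (LPA F G), fgip P -> ~ simple P ->
           exists D : seq (arrow (support_subgraph P)),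
             [/\ no_exit_cycle D,
                 (forall D' : seq (arrow (support_subgraph P)),
                    no_exit_cycle D' -> cycle_class D' = cycle_class D),
                 no_exit_cycle (subgraph_path D) &
                 Phi (cycle_class (subgraph_path D)) = iso_class P])].
Proof.
have cycle_vertex c : no_exit_cycle c -> exists v : vertex G, on_path v c.
  move=> [cc _]; have /is_cycleP[v [e [p [cE <- _ _ _]]]] := cc.
  by exists (src e); rewrite on_cycle_src // cE mem_head.
have mainP P : fgip P -> ~ simple P -> exists v : vertex G,
    (exists c, no_exit_cycle c /\ on_path v c) /\ module_iso P (vL F v).
  by move=> Pf Pn; have [v /on_cycleP vC Pv] := fgip_not_simple Pf Pn; exists v.
split=> //; exists (@cycle_module_class F G); split.
- split.
  + move=> _ [c cn ->]; have [v vc] := cycle_vertex c cn; exists (vL F v).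
    have vC := no_exit_on_cycle cn vc; split.
    * exact: vL_cycle_fgip.
    * exact: vL_cycle_not_simple.
    exact: cycle_module_classE.
  + move=> _ _ [c cn ->] [d dn ->].
    have [v vc] := cycle_vertex c cn; have [u ud] := cycle_vertex d dn.
    rewrite (cycle_module_classE F cn vc) (cycle_module_classE F dn ud) => /iso_class_inj.
    exact: vL_iso_cycle_class.
  move=> _ [P [Pf Pn ->]]; have [v [[c [cn vc]] Pv]] := mainP P Pf Pn.
  exists (cycle_class c); first by exists c.
  by rewrite (cycle_module_classE F cn vc) (iso_class_eq Pv).
- by move=> c v; exact: cycle_module_classE.
move=> P Pf Pn; have [v [[c [cn vc]] Pv]] := mainP P Pf Pn.
have [D [Dn Du DE]] := support_cycle Pv cn vc; exists D; rewrite DE; split=> //.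
by rewrite (cycle_module_classE F cn vc) (iso_class_eq Pv).
Qed.
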